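(* Let $(X_t)_{t\ge0}$ be an ergodic, time-homogeneous Markov process on $\mathbb{R}^d$ with invariant probability measure $\mu$ and transition semigroup $(P_t)_{t\ge0}$. Assume that there exist constants $C\ge1$ and $\lambda_{\mathrm E}>0$ such that for every probability measure $\nu$ on $\mathbb{R}^d$ and every $t\ge0$, $$\mathbb{W}_1(\nu P_t,\mu P_t)\le C e^{-\lambda_{\mathrm E}t}\,\mathbb{W}_1(\nu,\mu).$$ Let $p>0$ and assume that $\mu(|\cdot|^q)=\int_{\mathbb{R}^d}|x|^q\,\mu(\mathrm dx)<\infty$ for some $q>\max\{p,1\}$. Define $$\zeta:=\zeta(p,q,d):=\max\Big\{\frac{q}{q-p},\frac{d}{p}\Big\}\in(1,\infty).$$ Then there exists a constant $C'>0$ such that for all $T\ge2$, $$\mathbb{E}^\mu\big[\mathcal{T}_p(\mu_T,\mu)\big]\le C'\,T^{-\frac{p}{2\zeta p+1}}\Big((\log T)^{\frac{2d}{2d+1}}\mathbf 1_{\{q=\frac{dp}{d-p}\}}+\mathbf 1_{\{q\neq\frac{dp}{d-p}\}}\Big)\Big((\log T)^{\frac{2q}{2q+(q/d)-1}}\mathbf 1_{\{p=d\}}+\mathbf 1_{\{p\ne d\}}\Big).$$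
   Context: For probability measures $\nu_0,\nu_1$ on $\mathbb{R}^d$ and $p\in(0,\infty)$, $\mathcal{T}_p(\nu_0,\nu_1):=\inf_{\pi}\int|x-y|^p\,\pi(\mathrm dx,\mathrm dy)$, the infimum over all couplings $\pi$ of $\nu_0,\nu_1$; $\mathbb{W}_p:=\mathcal{T}_p^{\min\{1,1/p\}}$ is the $p$-Wasserstein distance. $\nu P_t$ denotes the law of $X_t$ when $X_0\sim\nu$, i.e. $(\nu P_t)(A)=\int P_t\mathbf 1_A\,\mathrm d\nu$ with $P_tf(x)=\mathbb{E}^x[f(X_t)]$. The empirical measure is $\mu_T:=\frac1T\int_0^T\delta_{X_t}\,\mathrm dt$. $\mathbb{E}^\mu$ denotes expectation when $X_0\sim\mu$. $\mathbf 1_{\{\cdot\}}$ equals $1$ if the stated condition on the parameters holds and $0$ otherwise. *)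

(* Defs.v *)
From HB Require Import structures.
From mathcomp Require Import all_boot all_order all_algebra.
From mathcomp Require Import all_classical all_reals all_analysis.
Set Implicit Arguments. Unset Strict Implicit. Unset Printing Implicit Defensive.
Import Order.TTheory GRing.Theory Num.Theory.
Import numFieldNormedType.Exports.
Local Open Scope classical_set_scope.
Local Open Scope ring_scope.

(* State space R^d is modelled as d.-tuple R, with the library's product
   (= Borel) sigma-algebra ([measurable_tuple] in measurable_structure.v). *)

Definition enorm (R : realType) (d : nat) (x : d.-tuple R) : R :=
  Num.sqrt (\sum_(i < d) (tnth x i) ^+ 2).

Definition edist (R : realType) (d : nat) (x y : d.-tuple R) : R :=
  Num.sqrt (\sum_(i < d) (tnth x i - tnth y i) ^+ 2).

Section defs.
Context (R : realType) (d : nat).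
Local Notation T := (d.-tuple R).

Definition is_coupling (nu0 nu1 : set T -> \bar R)
  (pi : probability (T * T)%type R) : Prop :=
  forall A : set T, measurable A ->
    pi (A `*` setT) = nu0 A /\ pi (setT `*` A) = nu1 A.

Definition Tp (p : R) (nu0 nu1 : set T -> \bar R) : \bar R :=
  ereal_inf [set c | exists pi : probability (T * T)%type R,
     is_coupling nu0 nu1 pi /\
     c = (\int[pi]_z ((edist z.1 z.2) `^ p)%:E)%E].

(* W_1 = T_1^{min{1,1/1}} = T_1. *)
Definition W1 (nu0 nu1 : set T -> \bar R) : \bar R := Tp 1 nu0 nu1.

Definition mker (nu : set T -> \bar R) (k : R.-pker T ~> T) : set T -> \bar R :=
  fun A => (\int[nu]_x k x A)%E.

Definition is_transition_semigroup (P : R -> R.-pker T ~> T) : Prop :=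
  (forall x (A : set T), measurable A -> P 0 x A = \d_x A) /\
  (forall s t, 0 <= s -> 0 <= t -> forall x (A : set T), measurable A ->
     P (s + t) x A = (\int[P s x]_y P t y A)%E).

Definition is_invariant (P : R -> R.-pker T ~> T) (mu : probability T R) : Prop :=
  forall t, 0 <= t -> forall A : set T, measurable A -> mker mu (P t) A = mu A.

Definition is_ergodic (P : R -> R.-pker T ~> T) (mu : probability T R) : Prop :=
  forall A : set T, measurable A ->
    (forall t, 0 <= t ->
       {ae mu, forall x, P t x A = (\1_A x)%:E}) ->
    mu A = 0%E \/ mu A = 1%E.

(* (X_t)_{t >= 0}, defined on (Omega, Pr), is a (measurable) time-homogeneous
   Markov process with transition semigroup P and initial law X_0 ~ nu:
   for s, t >= 0, A measurable, and every cylinder event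
   F = {X_{r_1} in B_1, ..., X_{r_n} in B_n} with r_i in [0, s]
   (these generate the past sigma-algebra at time s),
   Pr(F /\ X_{s+t} in A) = E[1_F P_t(X_s, A)]. *)
Definition is_markov_process (dO : measure_display) (Omega : measurableType dO)
  (Pr : probability Omega R) (X : R -> Omega -> T)
  (P : R -> R.-pker T ~> T) (nu : probability T R) : Prop :=
  measurable_fun setT (fun z : (R * Omega)%type => X z.1 z.2) /\
  (forall t, measurable_fun setT (X t)) /\
  (forall A : set T, measurable A -> Pr (X 0 @^-1` A) = nu A) /\
  (forall (n : nat) (r : 'I_n -> R) (B : 'I_n -> set T) (s t : R)
          (A : set T),
     0 <= s -> 0 <= t -> (forall i, 0 <= r i <= s) ->
     (forall i, measurable (B i)) -> measurable A ->
     Pr [set w | (forall i, B i (X (r i) w)) /\ A (X (s + t) w)] =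
     (\int[Pr]_(w in [set w | forall i, B i (X (r i) w)]) P t (X s w) A)%E).

Definition empirical (dO : measure_display) (Omega : measurableType dO)
  (X : R -> Omega -> T) (Tm : R) (w : Omega) : set T -> \bar R :=
  fun A => ((Tm^-1)%:E *
     \int[lebesgue_measure]_(t in `[0%R, Tm]) (\1_A (X t w))%:E)%E.

End defs.

(* Main.v *)
(* Idea: split R^d at scale [eps] by a Lipschitz partition of unity (products of
   clipped hat functions, the extreme ones absorbing the tails), so that both
   measures become weights on finitely many grid cells, and match these weights
   greedily along the dyadic tree of cells, from fine to coarse.  The cost is at most
   eps^p + sum_l (2^l eps)^p sum_v |mu_T(f_v) - mu(f_v)|, the f_v being the functions
   of level l.
   Applying the W_1-contraction to the initial law f mu / mu(f) bounds the covariance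
   of f(X_s) and f(X_t) by Lip(f) C exp(-lamE |t-s|) int f (|x| + mu|.|) dmu, hence
   E |mu_T(f_v) - mu(f_v)|^2 <= const (eps T)^-1 int f_v W dmu with W = const + |x|^q.
   At each level, the functions supported outside a ball of radius rho are bounded by
   the moment, the others by the variance; as only C (rho / 2^l eps)^d of them
   remain, optimising rho gives E T_p <= const eps^p with eps = T^(-1/(2 zeta p + 1)),
   up to rounding.  No logarithm appears. *)
Require Import Defs.
From HB Require Import structures.
From mathcomp Require Import all_boot all_order all_algebra.
From mathcomp Require Import all_classical all_reals all_analysis.
From mathcomp Require Import measurable_realfun ring lra zify.
Set Implicit Arguments. Unset Strict Implicit. Unset Printing Implicit Defensive.
Import Order.TTheory GRing.Theory Num.Theory.
Import numFieldNormedType.Exports.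
Local Open Scope classical_set_scope.
Local Open Scope ring_scope.
Local Notation edist := Defs.edist.

(** * Measures with a density *)

(** A contraction in [W1] controls Lipschitz test functions but not indicators of cells; this is why
    the cells are blurred. The price is that a coupling cannot be assembled by restricting measures
    to cells, so it is given by a density with respect to the product of the two measures. Tree
    matching forces coarse functions to be sums of fine ones. They are wide, but their slopes remain
    those of the finest scale, so the Lipschitz constant is of order [1 / eps] at every level. This
    is the origin of the [+ 1] in [2 zeta p + 1]: the scale must satisfy
    [(eps T)^-1 <= eps^(2 zeta p)]. The exponent [2 zeta p] acts as two halves [zeta p]. At the
    finest level, [zeta >= d / p] lets one half pay for the number of cells, of order [eps^-d] up to
    the growth of the radius, and [zeta >= q / (q - p)] lets the other pay for the tails; at the
    coarsest level both halves serve the tails. A geometric factor in the distance to the coarsest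
    level is left over, even when the two values inside [zeta] coincide, so that summing the levels
    costs only a constant. *)

Lemma ge0_le_integralT d (T : measurableType d) (R : realType)
    (m : {measure set T -> \bar R}) (f g : T -> \bar R) :
  (forall x, (0 <= f x)%E) -> (forall x, (f x <= g x)%E) ->
  (\int[m]_x f x <= \int[m]_x g x)%E.
Proof.
(* The integral of a nonnegative function is a supremum over the simple functions below it, so the
   comparison asks for no measurability of [f] or [g]. *)
move=> f0 fg; rewrite !ge0_integralTE//; last by move=> x; exact: le_trans (fg x).
by apply: ereal_sup_le => _ [h hf <-]; exists h => // x; exact: le_trans (fg x).
Qed.

Section density.
Context d (T : measurableType d) (R : realType) (m : {measure set T -> \bar R}).
Context (f : T -> R).

(** The proofs [mf] and [f0] are arguments so that the measure instance declared below is inferred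
    from the term [dens mf f0]. *)
Definition dens (mf : measurable_fun setT f) (f0 : forall x, 0 <= f x)
  (A : set T) : \bar R := (\int[m]_(x in A) (f x)%:E)%E.

Context (mf : measurable_fun setT f) (f0 : forall x, 0 <= f x).

Let dens0 : dens mf f0 set0 = 0%E.
Proof. by rewrite /dens integral_set0. Qed.

Let dens_ge0 A : (0 <= dens mf f0 A)%E.
Proof. by apply: integral_ge0 => x _; rewrite lee_fin. Qed.

Let dens_sigma_additive : semi_sigma_additive (dens mf f0).
Proof.
move=> /= F mF tF mUF; rewrite /dens; apply: cvg_toP.
  apply: ereal_nondecreasing_is_cvgn => k n kn.
  apply: lee_sum_nneg_natr => // i _ _.
  by apply: integral_ge0 => /= x Fkx; rewrite lee_fin.
rewrite ge0_integral_bigcup//=.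
- exact/measurable_EFinP/measurable_funTS.
- by move=> x _; rewrite lee_fin.
Qed.

HB.instance Definition _ := isMeasure.Build _ _ _ (dens mf f0)
  dens0 dens_ge0 dens_sigma_additive.

Import HBNNSimple.

Let integral_dens_nnsfun (g : {nnsfun T >-> R}) :
  (\int[dens mf f0]_x (g x)%:E = \int[m]_x ((f x)%:E * (g x)%:E))%E.
Proof.
under [LHS]eq_integral do rewrite fimfunE -fsumEFin//.
rewrite [LHS]ge0_integral_fsum//; last 2 first.
  - by move=> r; exact/measurable_EFinP/measurableT_comp.
  - by move=> n x _; rewrite EFinM nnfun_muleindic_ge0.
under [RHS]eq_integral.
  move=> x xD; rewrite fimfunE -fsumEFin// ge0_mule_fsumr; last first.
    by move=> r; rewrite EFinM nnfun_muleindic_ge0.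
  over.
rewrite [RHS]ge0_integral_fsum//; last 2 first.
  - move=> r; apply: emeasurable_funM; first exact/measurable_EFinP.
    by apply/measurable_EFinP; do 2 apply/measurableT_comp => //.
  - move=> n x _; rewrite EFinM mule_ge0//; last by rewrite nnfun_muleindic_ge0.
    by rewrite lee_fin.
apply: eq_fsbigr => r _; rewrite integralZl_indic_nnsfun//.
under [RHS]eq_integral do rewrite EFinM muleCA.
have mA : measurable (g @^-1` [set r]) by rewrite -[X in measurable X]setTI; exact: measurable_funPT.
(* The sum runs over all real values [r]; since [g] is nonnegative, a negative [r] has an empty
   level set. *)
have [r0|r0] := ltP r 0.
  have -> : g @^-1` [set r] = set0.
    apply/seteqP; split=> // x /= gxr.
    by have : 0 <= g x by []; rewrite gxr leNgt r0.
  rewrite integral_indic// set0I measure0 mule0 integral0_eq// => x _.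
  by rewrite indic0 mule0 mule0.
rewrite [RHS]ge0_integralZl//; last 2 first.
- apply: emeasurable_funM; first exact/measurable_EFinP.
  exact/measurable_EFinP/measurable_indic.
- by move=> x _; rewrite mule_ge0// lee_fin.
rewrite integral_indic// setIT; congr (_ * _)%E.
transitivity (\int[m]_(x in g @^-1` [set r]) (f x)%:E)%E => //.
rewrite integral_mkcond.
by apply: eq_integral => x _; rewrite patchE indicE; case: ifPn; rewrite ?mule1 ?mule0.
Qed.

Lemma integral_dens (g : T -> \bar R) :
  measurable_fun setT g -> (forall x, 0 <= g x)%E ->
  (\int[dens mf f0]_x g x = \int[m]_x ((f x)%:E * g x))%E.
Proof.
move=> mg g0; pose g_ := nnsfun_approx measurableT mg.
have gE x : (g x = limn (fun n => (g_ n x)%:E))%E.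
  by apply/esym/cvg_lim => //=; exact: cvg_nnsfun_approx.
have -> : (\int[dens mf f0]_x g x =
    limn (fun n => \int[dens mf f0]_x (g_ n x)%:E))%E.
  rewrite -monotone_convergence//=.
  - by apply: eq_integral => x _.
  - by move=> n; exact/measurable_EFinP/measurable_funTS.
  - by move=> n ? _; rewrite lee_fin.
  - by move=> ? _ ? ? mn; rewrite lee_fin; exact/lefP/nd_nnsfun_approx.
under eq_fun do rewrite integral_dens_nnsfun.
rewrite -monotone_convergence//=.
- apply: eq_integral => x _; rewrite limeMl//; first by rewrite -gE.
  by apply: (cvgP (g x)); exact: cvg_nnsfun_approx.
- by move=> n; apply: emeasurable_funM; exact/measurable_EFinP.
- by move=> n ? _; rewrite mule_ge0// lee_fin.
- move=> x _ a b ab; rewrite lee_pmul ?lee_fin//.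
  exact/lefP/nd_nnsfun_approx.
Qed.

End density.

Lemma ge0_integral_pushforwardT d1 d2 (T1 : measurableType d1) (T2 : measurableType d2)
    (R : realType) (m : {measure set T1 -> \bar R}) (phi : T1 -> T2) (f : T2 -> \bar R) :
  measurable_fun setT phi -> measurable_fun setT f -> (forall x, 0 <= f x)%E ->
  (\int[pushforward m phi]_y f y = \int[m]_x f (phi x))%E.
Proof.
by move=> mphi mf f0; rewrite ge0_integral_pushforward// => y _.
Qed.

(** * Greedy matching along a tree of partitions *)

Section greedy_matching.
Context (R : realFieldType) (S : finType).
Implicit Types (a b : S -> R) (g : S -> S).

Lemma sum_fibres (K : finType) (g : S -> K) (f : S -> R) :
  \sum_v \sum_(x | g x == v) f x = \sum_x f x.
Proof. by rewrite (partition_big g predT). Qed.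

(** In a fibre of masses [A] and [B], the mass [m = min A B] is matched in product form, each point
    in proportion to its weight. The side whose mass is [m] is exhausted, which gives the final
    alternative. Fibres of mass 0 need no separate formula because [x / 0 = 0]. *)
Lemma matching_step a b g :
  (forall x, 0 <= a x) -> (forall x, 0 <= b x) ->
  exists (c : S -> S -> R) (a' b' : S -> R),
    [/\ forall x y, 0 <= c x y, forall x y, c x y != 0 -> g x = g y,
        forall x, \sum_y c x y + a' x = a x & forall y, \sum_x c x y + b' y = b y]
    /\ [/\ forall x, 0 <= a' x, forall x, 0 <= b' x &
        forall v, \sum_(x | g x == v) a' x = 0 \/ \sum_(x | g x == v) b' x = 0].
Proof.
move=> a0 b0.
pose A v := \sum_(x | g x == v) a x; pose B v := \sum_(x | g x == v) b x.
have A0 v : 0 <= A v by exact: sumr_ge0.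
have B0 v : 0 <= B v by exact: sumr_ge0.
pose m v := Num.min (A v) (B v).
have m0 v : 0 <= m v by rewrite le_min A0 B0.
have mA v : m v / A v <= 1.
  have [->|/negPf Av] := eqVneq (A v) 0; first by rewrite invr0 mulr0.
  by rewrite ler_pdivrMr ?mul1r ?ge_min ?lexx// lt_neqAle eq_sym Av A0.
have mB v : m v / B v <= 1.
  have [->|/negPf Bv] := eqVneq (B v) 0; first by rewrite invr0 mulr0.
  by rewrite ler_pdivrMr ?mul1r ?ge_min ?lexx ?orbT// lt_neqAle eq_sym Bv B0.
have KA v : A v = 0 -> m v = 0.
  by move=> Av; apply/le_anti; rewrite m0 andbT /m Av ge_min lexx.
have KB v : B v = 0 -> m v = 0.
  by move=> Bv; apply/le_anti; rewrite m0 andbT /m Bv ge_min lexx orbT.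
exists (fun x y => if g x == g y then m (g x) / A (g x) / B (g x) * (a x * b y) else 0).
exists (fun x => (1 - m (g x) / A (g x)) * a x).
exists (fun x => (1 - m (g x) / B (g x)) * b x).
split; split.
- by move=> x y; case: ifP => // _; rewrite !mulr_ge0 ?invr_ge0.
- by move=> x y; case: (g x =P g y) => //; rewrite eqxx.
- move=> x; rewrite -big_mkcond/= -mulr_sumr -mulr_sumr.
  rewrite (eq_bigl (fun y => g y == g x)); last by move=> y; rewrite eq_sym.
  rewrite -/(B (g x)) mulrBl mul1r.
  have [B1|B1] := eqVneq (B (g x)) 0; first by rewrite KB// !mul0r subr0 add0r.
  by set u := m _ / A _; set w := B _ in B1 *; field.
- move=> y; rewrite -big_mkcond/=.
  rewrite (eq_bigr (fun x => m (g y) / A (g y) / B (g y) * b y * a x)); last first.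
    by move=> x /eqP ->; ring.
  rewrite -mulr_sumr -/(A (g y)) mulrBl mul1r.
  have [A1|A1] := eqVneq (A (g y)) 0.
    rewrite KA// !mul0r subr0.
    by rewrite add0r.
  rewrite (mulrAC (m _)); set u := m _ / B _; set w := A _ in A1 *; by field.
- by move=> x; rewrite mulr_ge0// subr_ge0.
- by move=> x; rewrite mulr_ge0// subr_ge0.
- move=> v.
  rewrite (eq_bigr (fun x => (1 - m v / A v) * a x)); last by move=> x /eqP ->.
  rewrite [in X in _ \/ X](eq_bigr (fun x => (1 - m v / B v) * b x)); last by move=> x /eqP ->.
  rewrite -!mulr_sumr -/(A v) -/(B v) /m minEle; case: ifP => _.
    left; have [->|A1] := eqVneq (A v) 0; first by rewrite mulr0.
    by rewrite divff// subrr mul0r.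
  right; have [->|A1] := eqVneq (B v) 0; first by rewrite mulr0.
  by rewrite divff// subrr mul0r.
Qed.

(** The [l^1] distance between the images of [a] and [b] under [g]. *)
Definition disc a b g := \sum_v `|\sum_(x | g x == v) a x - \sum_(x | g x == v) b x|.

(** What is matched at level [l.+1] is at most what level [l] left over. In each cell of level [l]
    one of the two residual weights is zero, so the other is the absolute value of their difference;
    and this difference is that of the original weights, because all mass matched so far stayed
    inside cells of level [l]. The last map is constant, so nothing is left after it. *)
Lemma tree_matching (g : nat -> S -> S) N a b :
  (forall l x y, g l x = g l y -> g l.+1 x = g l.+1 y) ->
  (forall x y, g N x = g N y) ->
  (forall x, 0 <= a x) -> (forall x, 0 <= b x) ->
  \sum_x a x = \sum_x b x ->
  exists c : nat -> S -> S -> R,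
    [/\ forall l x y, 0 <= c l x y, forall l x y, c l x y != 0 -> g l x = g l y,
        forall x, \sum_(l < N.+1) \sum_y c l x y = a x &
        forall y, \sum_(l < N.+1) \sum_x c l x y = b y] /\
    \sum_x \sum_y c 0 x y <= \sum_x a x /\
    forall l, (l < N)%N -> \sum_x \sum_y c l.+1 x y <= disc a b (g l).
Proof.
elim: N g a b => [|N IH] g a b gn gN a0 b0 ab.
  have [c [a' [b' [[c0 cg ca cb] [a'0 b'0 ab']]]]] := matching_step (g 0) a0 b0.
  have Ea : \sum_x \sum_y c x y + \sum_x a' x = \sum_x a x.
    by rewrite -big_split; apply: eq_bigr => x _; exact: ca.
  have Eb : \sum_x \sum_y c x y + \sum_x b' x = \sum_x b x.
    by rewrite exchange_big -big_split; apply: eq_bigr => x _; exact: cb.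
  have Eab : \sum_x a' x = \sum_x b' x by move: Ea Eb; rewrite ab; lra.
  (* There is a single fibre: one residual vanishes on it, hence both do, their totals being
     equal. *)
  have ZZ : \sum_x a' x = 0.
    case: (pickP (predT : pred S)) => [s _|S0]; last by rewrite big1// => i _; have := S0 i.
    have gs f : \sum_(x | g 0 x == g 0 s) f x = \sum_x f x :> R.
      by apply: eq_bigl => x; rewrite (gN x s) eqxx.
    by case: (ab' (g 0 s)); rewrite gs ?Eab.
  have a'E x : a' x = 0.
    by have /eqP := ZZ; rewrite psumr_eq0// => /allP/(_ x); rewrite mem_index_enum => /(_ erefl)/eqP.
  have b'E x : b' x = 0.
    by move: ZZ; rewrite Eab => /eqP; rewrite psumr_eq0// => /allP/(_ x); rewrite mem_index_enum => /(_ erefl)/eqP.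
  exists (fun l x y => if l is 0 then c x y else 0); split; [split|split].
  - by case.
  - by case=> [|l] x y; [exact: cg|rewrite eqxx].
  - by move=> x; rewrite big_ord1 -[RHS]ca a'E addr0.
  - by move=> y; rewrite big_ord1 -[RHS]cb b'E addr0.
  - by rewrite -Ea ZZ addr0.
  - by [].
have [c [a' [b' [[c0 cg ca cb] [a'0 b'0 ab']]]]] := matching_step (g 0) a0 b0.
have Ea : \sum_x \sum_y c x y + \sum_x a' x = \sum_x a x.
  by rewrite -big_split; apply: eq_bigr => x _; exact: ca.
have Eb : \sum_x \sum_y c x y + \sum_x b' x = \sum_x b x.
  by rewrite exchange_big -big_split; apply: eq_bigr => x _; exact: cb.
have Eab : \sum_x a' x = \sum_x b' x by move: Ea Eb; rewrite ab; lra.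
have gmon l x y : g 0 x = g 0 y -> g l x = g l y.
  by move=> xy; elim: l => // l; exact: gn.
have dE l v : \sum_(x | g l x == v) a' x - \sum_(x | g l x == v) b' x =
    \sum_(x | g l x == v) a x - \sum_(x | g l x == v) b x.
  (* Matched points share their cell at every later level, so the matched mass contributes equally
     to both sides and cancels in the difference. *)
  have H : \sum_(x | g l x == v) \sum_y c x y = \sum_(y | g l y == v) \sum_x c x y.
    rewrite [LHS]big_mkcond [RHS]big_mkcond/=.
    rewrite (eq_bigr (fun x => \sum_y if g l x == v then c x y else 0)); last first.
      by move=> x _; case: ifP => // _; rewrite big1.
    rewrite exchange_big; apply: eq_bigr => y _.
    transitivity (\sum_x if g l y == v then c x y else 0); last first.
      by case: (g l y == v); [apply: eq_bigr|rewrite big1].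
    apply: eq_bigr.
    move=> x _; have [->|cxy] := eqVneq (c x y) 0; first by rewrite !if_same.
    by rewrite (gmon l _ _ (cg _ _ cxy)).
  rewrite -[in RHS](eq_bigr _ (fun x _ => ca x)) -[X in _ = _ - X](eq_bigr _ (fun x _ => cb x)).
  by rewrite !big_split/= H; ring.
have [c' [[c'0 c'g c'a c'b] [c'1 c'2]]] :=
  IH (fun l => g l.+1) a' b' (fun l => gn l.+1) gN a'0 b'0 Eab.
exists (fun l x y => if l is l'.+1 then c' l' x y else c x y).
split; [split|split].
- by case.
- by case=> [|l] x y; [exact: cg|exact: c'g].
- by move=> x; rewrite big_ord_recl -[RHS]ca -c'a.
- by move=> y; rewrite big_ord_recl -[RHS]cb -c'b.
- by rewrite -Ea lerDl sumr_ge0.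
- case=> [_|l lN]; last first.
    have := c'2 l lN; congr (_ <= _).
    by apply: eq_bigr => v _; rewrite dE.
  apply: (le_trans c'1); rewrite -(sum_fibres (g 0) a') /disc.
  apply: ler_sum => v _; rewrite -dE; case: (ab' v) => ->.
    by rewrite normr_ge0.
  by rewrite subr0 ler_norm.
Qed.

End greedy_matching.

(** * Couplings from a matching of a partition of unity *)

Section expectation_of_bounded.
Context d (T : measurableType d) (R : realType) (m : probability T R).

Definition bounded01 (f : T -> R) :=
  measurable_fun setT f /\ forall x, 0 <= f x <= 1.

(** Since [fine] sends infinity to 0, this is the integral only when the latter is finite, which
    [bounded01] guarantees. *)
Definition expect (f : T -> R) : R := fine (\int[m]_x (f x)%:E).

Lemma expectE f : bounded01 f -> (\int[m]_x (f x)%:E = (expect f)%:E)%E.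
Proof.
move=> [mf f01]; rewrite /expect fineK// ge0_fin_numE; last first.
  by apply: integral_ge0 => x _; rewrite lee_fin; case/andP: (f01 x).
apply: (@le_lt_trans _ _ (\int[m]_x (1 : R)%:E)%E); last first.
  by rewrite integral_cst//= probability_setT mul1e ltry.
apply: ge0_le_integralT => x; rewrite lee_fin; by case/andP: (f01 x).
Qed.

Lemma expect_ge0 f : (forall x, 0 <= f x) -> 0 <= expect f.
Proof.
by move=> f0; rewrite fine_ge0//; apply: integral_ge0 => x _; rewrite lee_fin.
Qed.

Lemma expect_le f g : bounded01 f -> bounded01 g -> (forall x, f x <= g x) ->
  expect f <= expect g.
Proof.
move=> bf bg fg; rewrite -lee_fin -!expectE//.
apply: ge0_le_integralT => x; rewrite lee_fin //.
by case/andP: (bf.2 x).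
Qed.

Lemma expect1 : expect (fun=> 1) = 1.
Proof. by rewrite /expect integral_cst//= probability_setT mul1e. Qed.

Lemma expect_sum (I : finType) (P : pred I) (f : I -> T -> R) :
  (forall i, bounded01 (f i)) ->
  expect (fun x => \sum_(i | P i) f i x) = \sum_(i | P i) expect (f i).
Proof.
move=> bf; rewrite /expect.
under eq_integral do rewrite -sumEFin.
rewrite sum_fine; last by move=> i _; rewrite expectE.
congr fine; rewrite -big_filter -ge0_integral_sum//.
- by apply: eq_integral => x _; rewrite big_filter.
- by move=> i; have [mf _] := bf i; exact/measurable_EFinP.
- by move=> i x _; have [_ /(_ x)/andP[]] := bf i; rewrite lee_fin.
Qed.

End expectation_of_bounded.

Section product_integral.
Context d1 d2 (T1 : measurableType d1) (T2 : measurableType d2) (R : realType).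
Context (nu : probability T1 R) (mu : probability T2 R).

Lemma integral_prodM (f : T1 -> R) (g : T2 -> R) : bounded01 f -> bounded01 g ->
  (\int[nu \x mu]_z (f z.1 * g z.2)%:E = (expect nu f * expect mu g)%:E)%E.
Proof.
move=> bf bg; have [mf f01] := bf; have [mg g01] := bg.
have f0 x : 0 <= f x by case/andP: (f01 x).
have g0 x : 0 <= g x by case/andP: (g01 x).
rewrite fubini_tonelli1; last 2 first.
- by apply/measurable_EFinP/measurable_funM; exact: measurableT_comp.
- by move=> z; rewrite lee_fin mulr_ge0.
rewrite /fubini_F/=.
under eq_integral.
  move=> x _; under eq_integral do rewrite EFinM.
  rewrite ge0_integralZl_EFin//; last exact/measurable_EFinP; last first.
    by move=> y _; rewrite lee_fin.
  rewrite expectE// muleC; over.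
rewrite ge0_integralZl_EFin//.
- by rewrite expectE// -EFinM mulrC.
- by move=> x _; rewrite lee_fin.
- exact/measurable_EFinP.
- exact: expect_ge0.
Qed.

Lemma integral_sum_prod (I : finType) (k : I -> R) (f : I -> T1 -> R) (g : I -> T2 -> R) :
  (forall i, 0 <= k i) -> (forall i, bounded01 (f i)) -> (forall i, bounded01 (g i)) ->
  (\int[nu \x mu]_z (\sum_i k i * (f i z.1 * g i z.2))%:E =
   (\sum_i k i * (expect nu (f i) * expect mu (g i)))%:E)%E.
Proof.
move=> k0 bf bg.
have mfg i : measurable_fun setT (fun z : T1 * T2 => (f i z.1 * g i z.2)).
  apply: measurable_funM; apply: measurableT_comp => //.
  - by case: (bf i).
  - by case: (bg i).
have fg0 i z : 0 <= f i z.1 * g i z.2.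
  by have [_ /(_ z.1)/andP[? _]] := bf i; have [_ /(_ z.2)/andP[? _]] := bg i; rewrite mulr_ge0.
under eq_integral do rewrite -sumEFin.
rewrite ge0_integral_sum//.
- rewrite -sumEFin; apply: eq_bigr => i _.
  under eq_integral do rewrite EFinM.
  rewrite ge0_integralZl_EFin//; last exact/measurable_EFinP; last first.
    by move=> y _; rewrite lee_fin.
  by rewrite integral_prodM// -EFinM.
- move=> i; apply/measurable_EFinP/measurable_funM => //.
- by move=> i z _; rewrite lee_fin mulr_ge0.
Qed.

End product_integral.

Lemma bounded01_indic d (T : measurableType d) (R : realType) (A : set T) (f : T -> R) :
  measurable A -> bounded01 f -> bounded01 (fun x => \1_A x * f x).
Proof.
move=> mA [mf f01]; split=> [|x].
  by apply: measurable_funM => //; exact: measurable_indic.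
by rewrite indicE; case: (x \in A); rewrite ?mul1r ?mul0r ?f01 ?lexx ?ler01.
Qed.

Section couplings.
Context (R : realType) (d : nat).
Local Notation T := (d.-tuple R).
Context (nu mu : probability T R).

Lemma coupling_integral_fst (pi : probability (T * T)%type R) (f : T -> \bar R) :
  is_coupling nu mu pi -> measurable_fun setT f -> (forall x, 0 <= f x)%E ->
  (\int[pi]_z f z.1 = \int[nu]_x f x)%E.
Proof.
move=> cpi mf f0.
rewrite -(ge0_integral_pushforwardT pi measurable_fst mf f0).
apply: eq_measure_integral => A mA _; rewrite /pushforward.
by rewrite -[RHS](cpi A mA).1; congr (pi _); apply/seteqP; split=> [z Az|z []].
Qed.

Lemma coupling_integral_snd (pi : probability (T * T)%type R) (f : T -> \bar R) :
  is_coupling nu mu pi -> measurable_fun setT f -> (forall x, 0 <= f x)%E ->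
  (\int[pi]_z f z.2 = \int[mu]_x f x)%E.
Proof.
move=> cpi mf f0.
rewrite -(ge0_integral_pushforwardT pi measurable_snd mf f0).
apply: eq_measure_integral => A mA _; rewrite /pushforward.
by rewrite -[RHS](cpi A mA).2; congr (pi _); apply/seteqP; split=> [z Az|z []].
Qed.

Section from_discrete.
Context (S : finType) (phi : S -> T -> R) (c : S -> S -> R).
Hypothesis bphi : forall F, bounded01 (phi F).
Hypothesis sum_phi : forall x, \sum_F phi F x = 1.
Hypothesis c0 : forall F G, 0 <= c F G.
Hypothesis c_fst : forall F, \sum_G c F G = expect nu (phi F).
Hypothesis c_snd : forall G, \sum_F c F G = expect mu (phi G).

Let a F := expect nu (phi F).
Let b G := expect mu (phi G).
Let k (i : S * S) := c i.1 i.2 / (a i.1 * b i.2).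

Let phi0 F x : 0 <= phi F x. Proof. by case: (bphi F) => _ /(_ x)/andP[]. Qed.
Let a0 F : 0 <= a F. Proof. exact: expect_ge0. Qed.
Let b0 F : 0 <= b F. Proof. exact: expect_ge0. Qed.
Let k0 i : 0 <= k i. Proof. by rewrite divr_ge0// mulr_ge0. Qed.

Let ca F G : a F = 0 -> c F G = 0.
Proof.
rewrite /a -c_fst => /eqP; rewrite psumr_eq0// => /allP/(_ G).
by rewrite mem_index_enum => /(_ erefl)/eqP.
Qed.

Let cb F G : b G = 0 -> c F G = 0.
Proof.
rewrite /b -c_snd => /eqP; rewrite psumr_eq0// => /allP/(_ F).
by rewrite mem_index_enum => /(_ erefl)/eqP.
Qed.

(** Density of the coupling with respect to [nu \x mu]. Integrating out the second variable turns
    [phi G] into [b G] and leaves [\sum_F phi F x / a F * \sum_G c F G], that is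
    [\sum_F phi F x = 1]. Null weights do no harm: by [ca] and [cb] they force [c F G = 0], and a
    function of mean 0 vanishes almost everywhere. *)
Let D (z : T * T) : R := \sum_i k i * (phi i.1 z.1 * phi i.2 z.2).

Let D0 z : 0 <= D z.
Proof.
by apply: sumr_ge0 => i _; exact: mulr_ge0 (k0 _) (mulr_ge0 (phi0 _ _) (phi0 _ _)).
Qed.

Let mD : measurable_fun setT D.
Proof.
apply: measurable_sum => i; apply: measurable_funM => //.
by apply: measurable_funM; apply: measurableT_comp => //;
  [case: (bphi i.1)|case: (bphi i.2)].
Qed.

Let pi0 := dens (nu \x mu)%E mD D0.

Let pi_fst A : measurable A -> pi0 (A `*` setT) = nu A.
Proof.
move=> mA.
transitivity (\int[nu \x mu]_z (\sum_i k i * ((\1_A z.1 * phi i.1 z.1) * phi i.2 z.2))%:E)%E.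
  rewrite /pi0 /dens integral_mkcond; apply: eq_integral => z _.
  rewrite patchE -[X in _ = X%:E]/(\sum_i _).
  case: ifPn => [|/negP zA].
    rewrite inE => -[Az _]; congr EFin; apply: eq_bigr => i _.
    by rewrite indicE mem_set// mul1r.
  rewrite big1// => i _; rewrite indicE memNset ?mul0r ?mulr0// => Az.
  by apply: zA; rewrite inE.
rewrite (integral_sum_prod _ _ (f := fun i x => \1_A x * phi i.1 x) (g := fun i => phi i.2))//; last first.
  by move=> i; exact: bounded01_indic.
transitivity (\sum_F expect nu (fun x => \1_A x * phi F x))%:E; last first.
  rewrite -expect_sum; last by move=> F; exact: bounded01_indic.
  rewrite -expectE; last first.
    split=> [|x].
      apply: measurable_sum => F; apply: measurable_funM; first exact: measurable_indic.
      by case: (bphi F).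
    rewrite -mulr_sumr sum_phi mulr1 indicE; by case: (x \in A); rewrite ?lexx ?ler01.
  under eq_integral do rewrite -mulr_sumr sum_phi mulr1.
  by rewrite integral_indic// setIT.
congr EFin; rewrite -(pair_bigA _ (fun F G => k (F, G) * (expect nu (fun x => \1_A x * phi F x) * b G)))/=.
apply: eq_bigr => F _.
have [aF|aF] := eqVneq (a F) 0.
  rewrite big1 => [|G _]; last by rewrite /k/= ca// !mul0r.
  apply/esym/le_anti; rewrite expect_ge0 ?andbT => [|x]; last by rewrite mulr_ge0.
  rewrite -aF; apply: expect_le => // [|x]; first exact: bounded01_indic.
  by rewrite indicE; case: (x \in A); rewrite ?mul1r ?mul0r.
rewrite (eq_bigr (fun G => expect nu (fun x => \1_A x * phi F x) / a F * c F G)).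
  by rewrite -mulr_sumr c_fst -/(a F) divfK.
move=> G _; rewrite /k/=; have [bG|bG] := eqVneq (b G) 0.
  by rewrite bG cb// !mulr0.
by field; rewrite aF bG.
Qed.

Let pi_snd A : measurable A -> pi0 (setT `*` A) = mu A.
Proof.
move=> mA.
transitivity (\int[nu \x mu]_z (\sum_i k i * (phi i.1 z.1 * (\1_A z.2 * phi i.2 z.2)))%:E)%E.
  rewrite /pi0 /dens integral_mkcond; apply: eq_integral => z _.
  rewrite patchE -[X in _ = X%:E]/(\sum_i _).
  case: ifPn => [|/negP zA].
    rewrite inE => -[_ Az]; congr EFin; apply: eq_bigr => i _.
    by rewrite indicE mem_set// mul1r.
  rewrite big1// => i _; rewrite indicE memNset ?mul0r ?mulr0// => Az.
  by apply: zA; rewrite inE.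
rewrite (integral_sum_prod _ _ (f := fun i => phi i.1) (g := fun i x => \1_A x * phi i.2 x))//; last first.
  by move=> i; exact: bounded01_indic.
transitivity (\sum_F expect mu (fun x => \1_A x * phi F x))%:E; last first.
  rewrite -expect_sum; last by move=> F; exact: bounded01_indic.
  rewrite -expectE; last first.
    split=> [|x].
      apply: measurable_sum => F; apply: measurable_funM; first exact: measurable_indic.
      by case: (bphi F).
    rewrite -mulr_sumr sum_phi mulr1 indicE; by case: (x \in A); rewrite ?lexx ?ler01.
  under eq_integral do rewrite -mulr_sumr sum_phi mulr1.
  by rewrite integral_indic// setIT.
congr EFin; rewrite -(pair_bigA _ (fun F G => k (F, G) * (a F * expect mu (fun x => \1_A x * phi G x))))/=.
rewrite exchange_big; apply: eq_bigr => G _.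
have [bG|bG] := eqVneq (b G) 0.
  rewrite big1 => [|F _]; last by rewrite /k/= cb// !mul0r.
  apply/esym/le_anti; rewrite expect_ge0 ?andbT => [|x]; last by rewrite mulr_ge0.
  rewrite -bG; apply: expect_le => // [|x]; first exact: bounded01_indic.
  by rewrite indicE; case: (x \in A); rewrite ?mul1r ?mul0r.
rewrite (eq_bigr (fun F => expect mu (fun x => \1_A x * phi G x) / b G * c F G)).
  by rewrite -mulr_sumr c_snd -/(b G) divfK.
move=> F _; rewrite /k/=; have [aF|aF] := eqVneq (a F) 0.
  by rewrite aF ca// !mul0r mulr0.
by field; rewrite aF bG.
Qed.

Let pi_setT : pi0 setT = 1%E.
Proof. by rewrite -setXTT pi_fst// probability_setT. Qed.

HB.instance Definition _ := isMeasure.Build _ _ _ pi0 (measure0 pi0)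
  (measure_ge0 pi0) (@measure_semi_sigma_additive _ _ _ pi0).
HB.instance Definition _ := Measure_isProbability.Build _ _ _ pi0 pi_setT.

(** The extreme cells are unbounded, so no bound by pairs of cells can control the cost on them. The
    term in [w] takes over there; being a sum of functions of one variable, it is integrated against
    the marginals alone, whatever the matching. *)
Lemma coupling_from_discrete (cost : T * T -> R) (E : S -> S -> R) (w : T -> R) (e : R) :
  measurable_fun setT cost -> (forall z, 0 <= cost z) ->
  measurable_fun setT w -> (forall x, 0 <= w x) ->
  (forall F G, 0 <= E F G) -> 0 <= e ->
  (forall F G x y, c F G != 0 -> phi F x != 0 -> phi G y != 0 ->
     cost (x, y) <= E F G + e * (w x + w y)) ->
  exists pi : probability (T * T)%type R, is_coupling nu mu pi /\
    (\int[pi]_z (cost z)%:E <= (\sum_F \sum_G c F G * E F G)%:E +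
      e%:E * (\int[nu]_x (w x)%:E + \int[mu]_x (w x)%:E))%E.
Proof.
move=> mcost cost0 mw w0 E0 e0 costE.
pose pi : probability (T * T)%type R := pi0.
exists pi.
have cpi : is_coupling nu mu pi by move=> A mA; split; [exact: pi_fst|exact: pi_snd].
split=> //.
have mw1 : measurable_fun setT (fun z : T * T => w z.1) by exact: measurableT_comp.
have mw2 : measurable_fun setT (fun z : T * T => w z.2) by exact: measurableT_comp.
have mww : measurable_fun setT (fun z : T * T => (e%:E * ((w z.1)%:E + (w z.2)%:E))%E).
  by apply/measurable_EFinP; apply: measurable_funM => //; exact: measurable_funD.
pose H z : R := \sum_i (k i * E i.1 i.2) * (phi i.1 z.1 * phi i.2 z.2).
have H0 z : 0 <= H z.
  apply: sumr_ge0 => i _.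
  exact: mulr_ge0 (mulr_ge0 (k0 _) (E0 _ _)) (mulr_ge0 (phi0 _ _) (phi0 _ _)).
have mH : measurable_fun setT H.
  apply: measurable_sum => i; apply: measurable_funM => //.
  by apply: measurable_funM; apply: measurableT_comp => //;
    [case: (bphi i.1)|case: (bphi i.2)].
have -> : (\int[pi]_z (cost z)%:E = \int[nu \x mu]_z ((D z)%:E * (cost z)%:E))%E.
  by rewrite integral_dens//; exact/measurable_EFinP.
apply: (@le_trans _ _ (\int[nu \x mu]_z ((H z)%:E + (D z)%:E * (e%:E * ((w z.1)%:E + (w z.2)%:E))))%E).
  apply: ge0_le_integralT => z; first by rewrite mule_ge0 ?lee_fin.
  rewrite -(EFinD (w _)) -!EFinM -(EFinD (H z)) lee_fin /D /H !mulr_suml -big_split/=.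
  apply: ler_sum => i _.
  have [->|ki] := eqVneq (k i) 0; first by rewrite !mul0r addr0.
  have [->|p1] := eqVneq (phi i.1 z.1) 0; first by rewrite !(mul0r, mulr0) addr0.
  have [->|p2] := eqVneq (phi i.2 z.2) 0; first by rewrite !(mul0r, mulr0) addr0.
  have ci : c i.1 i.2 != 0 by apply: contra ki => /eqP ci; rewrite /k ci mul0r.
  have := costE _ _ _ _ ci p1 p2; rewrite -surjective_pairing.
  move=> /(ler_wpM2l (mulr_ge0 (k0 i) (mulr_ge0 (phi0 i.1 z.1) (phi0 i.2 z.2)))).
  by move=> /le_trans; apply; rewrite le_eqVlt; apply/orP; left; apply/eqP; ring.
rewrite ge0_integralD//; last 4 first.
- by move=> z _; rewrite lee_fin.
- exact/measurable_EFinP.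
- by move=> z _; rewrite -(EFinD (w _)) -!EFinM lee_fin mulr_ge0 ?mulr_ge0 ?addr_ge0.
- by apply: emeasurable_funM => //; exact/measurable_EFinP.
apply: leeD.
  rewrite (integral_sum_prod _ _ (k := fun i => k i * E i.1 i.2) (f := fun i => phi i.1) (g := fun i => phi i.2))//; last first.
    by move=> i; rewrite mulr_ge0.
  rewrite lee_fin (pair_bigA _ (fun F G => c F G * E F G))/=.
  apply: ler_sum => i _.
  rewrite -/(a i.1) -/(b i.2) /k.
  have [ai|ai] := eqVneq (a i.1) 0; first by rewrite ca// !mul0r.
  have [bi|bi] := eqVneq (b i.2) 0; first by rewrite cb// !mul0r.
  by rewrite le_eqVlt; apply/orP; left; apply/eqP; field; rewrite ai bi.
rewrite -(integral_dens _ mD D0)//; last by move=> z; rewrite -(EFinD (w _)) -!EFinM lee_fin mulr_ge0 ?addr_ge0.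
rewrite -[X in (X <= _)%E]/(\int[pi]_z _)%E ge0_integralZl_EFin//; last 2 first.
- by move=> z _; rewrite -(EFinD (w _)) lee_fin addr_ge0.
- by apply/measurable_EFinP; exact: measurable_funD.
rewrite ge0_integralD//; last 4 first.
- by move=> z _; rewrite lee_fin.
- exact/measurable_EFinP.
- by move=> z _; rewrite lee_fin.
- exact/measurable_EFinP.
have wE : measurable_fun setT (fun x => (w x)%:E) by exact/measurable_EFinP.
have wE0 x : (0 <= (w x)%:E)%E by rewrite lee_fin.
by rewrite (coupling_integral_fst cpi wE wE0) (coupling_integral_snd cpi wE wE0).
Qed.

End from_discrete.
End couplings.

(** * Covariance decay *)

Lemma measurable_enorm (R : realType) d : measurable_fun setT (@enorm R d).
Proof.
apply: measurableT_comp; first exact: continuous_measurable_fun (@sqrt_continuous R).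
apply: measurable_sum => i; apply: measurable_funX; exact: measurable_tnth.
Qed.

Lemma measurable_edist (R : realType) d :
  measurable_fun setT (fun z : d.-tuple R * d.-tuple R => edist z.1 z.2).
Proof.
apply: measurableT_comp; first exact: continuous_measurable_fun (@sqrt_continuous R).
apply: measurable_sum => i; apply: measurable_funX.
by apply: measurable_funB; apply: (measurableT_comp (measurable_tnth i)).
Qed.

Lemma edist_coord_le (R : realType) d (x y : d.-tuple R) (D : R) :
  0 <= D -> (forall i, `|tnth x i - tnth y i| <= D) -> edist x y <= d%:R * D.
Proof.
move=> D0 xyD; have dD : 0 <= d%:R * D by rewrite mulr_ge0.
rewrite -(ger0_norm dD) -sqrtr_sqr ler_wsqrtr// exprMn.
apply: (@le_trans _ _ (\sum_(i < d) D ^+ 2)).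
  by apply: ler_sum => i _; rewrite -real_normK ?num_real// ler_pXn2r ?nnegrE.
rewrite sumr_const card_ord -[X in X <= _]mulr_natl ler_wpM2r ?exprn_ge0//.
by rewrite -natrX ler_nat; case: (d) => // n; rewrite -{1}(expn1 n.+1) leq_pexp2l.
Qed.

Lemma coord_le_edist (R : realType) d (x y : d.-tuple R) i :
  `|tnth x i - tnth y i| <= edist x y.
Proof.
rewrite -sqrtr_sqr ler_wsqrtr// (bigD1 i)//= lerDl sumr_ge0// => j _.
exact: sqr_ge0.
Qed.

Lemma coord_le_enorm (R : realType) d (x : d.-tuple R) i : `|tnth x i| <= enorm x.
Proof.
rewrite -sqrtr_sqr ler_wsqrtr// (bigD1 i)//= lerDl sumr_ge0// => j _.
exact: sqr_ge0.
Qed.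

Lemma edist_le_enorm (R : realType) d (x y : d.-tuple R) :
  edist x y <= d%:R * (enorm x + enorm y).
Proof.
apply: edist_coord_le => [|i]; first by rewrite addr_ge0 ?sqrtr_ge0.
by rewrite (le_trans (ler_normB _ _))// lerD ?coord_le_enorm.
Qed.

Definition edist_lipschitz (R : realType) d (K : R) (f : d.-tuple R -> R) :=
  forall x y, `|f x - f y| <= K * edist x y.

Section covariance.
Context (R : realType) (d : nat) (dO : measure_display) (Omega : measurableType dO).
Context (Pr : probability Omega R).
Local Notation T := (d.-tuple R).
Context (X : R -> Omega -> T) (P : R -> R.-pker T ~> T) (mu : probability T R).
Context (C lamE : R).
Hypothesis invP : is_invariant P mu.
Hypothesis markX : is_markov_process Pr X P mu.
Hypothesis C0 : 0 <= C.
Hypothesis contrP : forall (nu : probability T R) (t : R), 0 <= t ->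
     (W1 (mker nu (P t)) (mker mu (P t)) <=
      (C * expR (- lamE * t))%:E * W1 nu mu)%E.

Let mX t : measurable_fun setT (X t). Proof. by case: markX => _ []. Qed.

Let mXpre t A : measurable A -> measurable (X t @^-1` A).
Proof. by move=> mA; rewrite -[X in measurable X]setTI; exact: mX. Qed.

Lemma markov_joint_law s t (A B : set T) : 0 <= s -> 0 <= t ->
  measurable A -> measurable B ->
  Pr (X s @^-1` B `&` X (s + t) @^-1` A) =
  (\int[Pr]_(w in X s @^-1` B) P t (X s w) A)%E.
Proof.
move=> s0 t0 mA mB; have [_ [_ [_ mark]]] := markX.
have := mark 1%N (fun=> s) (fun=> B) s t A s0 t0.
have -> : [set w | (forall i : 'I_1, B (X s w)) /\ A (X (s + t) w)] =
   X s @^-1` B `&` X (s + t) @^-1` A.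
  by apply/seteqP; split=> w /= [H1 H2]; split => //; exact: H1 ord0.
have -> : [set w | 'I_1 -> B (X s w)] = X s @^-1` B.
  by apply/seteqP; split=> w /= H //; exact: H ord0.
by apply=> //; rewrite s0 lexx.
Qed.

Lemma marginal_law s (A : set T) : 0 <= s -> measurable A -> Pr (X s @^-1` A) = mu A.
Proof.
move=> s0 mA; have [_ [_ [X0 _]]] := markX.
have := @markov_joint_law 0 s A setT (lexx 0) s0 mA measurableT.
rewrite preimage_setT setTI add0r => ->; rewrite -(invP s0 mA) /mker.
rewrite -(ge0_integral_pushforwardT Pr (f := fun x => P s x A) (mX 0))//.
- by apply: eq_measure_integral => B mB _; exact: X0.
- exact: measurable_kernel.
Qed.

Lemma integral_marginal s (f : T -> \bar R) : 0 <= s ->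
  measurable_fun setT f -> (forall x, 0 <= f x)%E ->
  (\int[Pr]_w f (X s w) = \int[mu]_x f x)%E.
Proof.
move=> s0 mf f0.
rewrite -(ge0_integral_pushforwardT Pr (mX s) mf f0).
by apply: eq_measure_integral => B mB _; exact: marginal_law.
Qed.

Let kle1 t x A : measurable A -> (P t x A <= 1)%E.
Proof. by move=> mA; rewrite -(prob_kernel (s := P t) x) le_measure ?inE. Qed.

Let kfin t x A : measurable A -> P t x A \is a fin_num.
Proof.
by move=> mA; rewrite ge0_fin_numE// (le_lt_trans (kle1 t x mA))// ltry.
Qed.

(** The Markov property is given for events. Both sides are integrals of [f] against a measure on
    the state space, namely the law of [X s] on the event that [X (s + t)] is in [A], and
    [P t x A mu(dx)]; the two agree on every [B] by [markov_joint_law]. *)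
Lemma markov_joint_integral (f : T -> R) s t (A : set T) :
  bounded01 f -> 0 <= s -> 0 <= t -> measurable A ->
  (\int[Pr]_(w in X (s + t)%R @^-1` A) (f (X s w))%:E =
   \int[mu]_x ((f x)%:E * P t x A))%E.
Proof.
move=> [mf f01] s0 t0 mA.
have f0 x : 0 <= f x by case/andP: (f01 x).
have mfE : measurable_fun setT (fun x => (f x)%:E) by exact/measurable_EFinP.
have fE0 x : (0 <= (f x)%:E)%E by rewrite lee_fin.
have mi : measurable_fun setT (fun w => \1_A (X (s + t) w) : R).
  exact: (@measurable_indic _ _ R setT _ (mXpre (s + t) mA)).
have i0 w : 0 <= \1_A (X (s + t) w) :> R by rewrite indicE.
have mk : measurable_fun setT (fun x => fine (P t x A)).
  by apply: measurableT_comp => //; exact: measurable_kernel.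
have k0 x : 0 <= fine (P t x A) by rewrite fine_ge0.
transitivity (\int[pushforward (dens Pr mi i0) (X s)]_x (f x)%:E)%E.
  rewrite (ge0_integral_pushforwardT _ (mX s) mfE fE0) integral_dens//; last first.
    by apply/measurable_EFinP; apply: measurableT_comp.
  rewrite [LHS]integral_mkcond; apply: eq_integral => w _.
  rewrite patchE indicE.
  have -> : (w \in X (s + t) @^-1` A) = (X (s + t) w \in A) by apply/idP/idP; rewrite !inE.
  by case: ifP; rewrite ?mul1e ?mul0e.
transitivity (\int[dens mu mk k0]_x (f x)%:E)%E; last first.
  rewrite integral_dens//.
  by apply: eq_integral => x _; rewrite muleC fineK ?kfin.
apply: eq_measure_integral => B mB _; rewrite /pushforward.
transitivity (Pr (X s @^-1` B `&` X (s + t) @^-1` A)).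
  rewrite -[LHS]/(\int[Pr]_(w in X s @^-1` B) (\1_(X (s + t) @^-1` A) w)%:E)%E.
  by rewrite (integral_indic Pr (mXpre s mB) (mXpre (s + t) mA)) setIC.
rewrite markov_joint_law//.
rewrite -[RHS]/(\int[mu]_(x in B) (fine (P t x A))%:E)%E.
rewrite [LHS]integral_mkcond [RHS]integral_mkcond.
rewrite -(integral_marginal s0); last 2 first.
- apply/(measurable_restrictT (fun x => (fine (P t x A))%:E) mB).
  by apply: measurable_funTS; exact/measurable_EFinP.
- by move=> x; apply: erestrict_ge0 => y _; rewrite lee_fin.
apply: eq_integral => w _; rewrite !patchE.
have -> : (w \in X s @^-1` B) = (X s w \in B) by apply/idP/idP; rewrite !inE.
by case: ifP => // _; rewrite fineK ?kfin.
Qed.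

Context (W : T -> R).
Hypothesis mW : measurable_fun setT W.
Hypothesis W_enorm : forall x, (\int[mu]_y (enorm y)%:E + (enorm x)%:E <= (W x)%:E)%E.
Hypothesis W_int : (\int[mu]_x (W x)%:E < +oo)%E.

Let W0 x : 0 <= W x.
Proof.
rewrite -lee_fin (le_trans _ (W_enorm x))// adde_ge0 ?lee_fin ?sqrtr_ge0//.
by apply: integral_ge0 => y _; rewrite lee_fin sqrtr_ge0.
Qed.

Let mWE : measurable_fun setT (fun x => (W x)%:E).
Proof. exact/measurable_EFinP. Qed.

Let WE0 x : (0 <= (W x)%:E)%E. Proof. by rewrite lee_fin. Qed.

Lemma weighted_fin f : bounded01 f ->
  (\int[mu]_x (f x * W x)%:E = (expect mu (fun x => (f x * W x)%R))%:E)%E.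
Proof.
move=> [mf f01]; rewrite fineK// ge0_fin_numE; last first.
  by apply: integral_ge0 => x _; rewrite lee_fin mulr_ge0//; case/andP: (f01 x).
apply: le_lt_trans W_int; apply: ge0_le_integralT => x; rewrite lee_fin.
  by rewrite mulr_ge0//; case/andP: (f01 x).
by rewrite ler_piMl//; case/andP: (f01 x).
Qed.

(** The independent coupling is enough, since smallness will come from the contraction. The distance
    is at most [d (|x| + |y|)], and integrating out [y] leaves at most [d W(x)]. The factor
    [1 / expect mu f] will cancel in [covariance_le], so functions of small mean are not
    penalised. *)
Lemma W1_density_le (f : T -> R) (nu : probability T R) : bounded01 f ->
  0 < expect mu f ->
  (forall g : T -> \bar R, measurable_fun setT g -> (forall x, 0 <= g x)%E ->
    \int[nu]_x g x = \int[mu]_x ((f x / expect mu f)%:E * g x))%E ->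
  (W1 nu mu <= (d%:R * (expect mu (fun x => (f x * W x)%R) / expect mu f))%:E)%E.
Proof.
move=> bf a0 nuE; have [mf f01] := bf.
have f0 x : 0 <= f x by case/andP: (f01 x).
apply: (@le_trans _ _ (\int[nu \x mu]_z (edist z.1 z.2)%:E)%E).
  apply: ereal_inf_lbound; exists (nu \x mu)%E; split.
    move=> A mA; split.
      by rewrite [LHS](product_measure1E nu mu mA measurableT)/= probability_setT mule1.
    by rewrite [LHS](product_measure1E nu mu measurableT mA)/= probability_setT mul1e.
  by apply: eq_integral => z _; rewrite powRr1// sqrtr_ge0.
have me := @measurable_enorm R d.
have en0 (x : T) : 0 <= enorm x by rewrite sqrtr_ge0.
apply: (@le_trans _ _ (\int[nu \x mu]_z (d%:R%:E * ((enorm z.1)%:E + (enorm z.2)%:E)))%E).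
  apply: ge0_le_integralT => z; first by rewrite lee_fin sqrtr_ge0.
  by rewrite -EFinD -EFinM lee_fin edist_le_enorm.
rewrite fubini_tonelli1; last 2 first.
- apply/measurable_EFinP; apply: measurable_funM => //; apply: measurable_funD.
    by apply: measurableT_comp.
  by apply: measurableT_comp.
- by move=> z; rewrite -EFinD -EFinM lee_fin mulr_ge0// addr_ge0.
rewrite /fubini_F/=.
apply: (@le_trans _ _ (\int[nu]_x (d%:R%:E * (W x)%:E))%E).
  apply: ge0_le_integralT => x.
    apply: integral_ge0 => y _.
    by rewrite -EFinD -EFinM lee_fin mulr_ge0// addr_ge0.
  rewrite ge0_integralZl_EFin//; last 2 first.
  - by move=> y _; rewrite -EFinD lee_fin addr_ge0.
  - by apply/measurable_EFinP; exact: measurable_funD.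
  apply: lee_wpmul2l; first by rewrite lee_fin.
  rewrite ge0_integralD//; last 3 first.
  - by move=> y _; rewrite lee_fin.
  - by move=> y _; rewrite lee_fin.
  - exact/measurable_EFinP.
  have -> : (\int[mu]__ (enorm x)%:E = (enorm x)%:E)%E.
    by rewrite integral_cst//= probability_setT mule1.
  by rewrite addeC.
rewrite ge0_integralZl_EFin// nuE//.
rewrite EFinM; apply: lee_wpmul2l; first by rewrite lee_fin.
rewrite (_ : (\int[mu]_x _)%E = (\int[mu]_x ((expect mu f)^-1%:E * (f x * W x)%:E))%E); last first.
  by apply: eq_integral => x _; rewrite -!EFinM; congr EFin; ring.
rewrite ge0_integralZl_EFin//; last 3 first.
- by move=> y _; rewrite lee_fin mulr_ge0.
- by apply/measurable_EFinP; exact: measurable_funM.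
- by rewrite invr_ge0 ltW.
by rewrite weighted_fin// -EFinM mulrC.
Qed.

(** With [a] the mean of [f] and [nu] of density [f / a], the left side is [a] times the integral of
    [f] against [nu P_t]. It exceeds [a ^+ 2] by at most [a K] times the [W1] distance of [nu P_t]
    and [mu P_t]: this is the easy half of Kantorovich duality, checked coupling by coupling. *)
Lemma covariance_le (f : T -> R) (K s t : R) :
  bounded01 f -> 0 < K -> edist_lipschitz K f -> 0 <= s -> 0 <= t ->
  (\int[Pr]_w (f (X s w) * f (X (s + t)%R w))%:E <=
   (expect mu f ^+ 2 +
    K * d%:R * C * expR (- lamE * t) * expect mu (fun x => (f x * W x)%R))%:E)%E.
Proof.
move=> bf K0 Kf s0 t0; have [mf f01] := bf.
have f0 x : 0 <= f x by case/andP: (f01 x).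
have mfE : measurable_fun setT (fun x => (f x)%:E) by exact/measurable_EFinP.
have fE0 x : (0 <= (f x)%:E)%E by rewrite lee_fin.
set a := expect mu f; set M := expect mu (fun x => _).
have M0 : 0 <= M by apply: expect_ge0 => x; rewrite mulr_ge0.
have a0 : 0 <= a by apply: expect_ge0.
have rhs0 : 0 <= a ^+ 2 + K * d%:R * C * expR (- lamE * t) * M.
  by rewrite addr_ge0 ?exprn_ge0// !mulr_ge0 ?expR_ge0// ltW.
have st0 : 0 <= s + t by rewrite addr_ge0.
(* With mean 0 there is no density to normalise; the product is then at most [f (X s)], whose
   integral is 0. *)
have [a_eq0|a_neq0] := eqVneq a 0.
  apply: (@le_trans _ _ (\int[Pr]_w (f (X s w))%:E)%E).
    apply: ge0_le_integralT => w; rewrite lee_fin ?mulr_ge0//.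
    by rewrite ler_piMr//; case/andP: (f01 (X (s + t) w)).
  rewrite (integral_marginal s0 mfE fE0).
  by rewrite expectE// -/a {1}a_eq0 lee_fin.
have a_gt0 : 0 < a by rewrite lt_neqAle eq_sym a_neq0.
have mg : measurable_fun setT (fun x => f x / a) by exact: measurable_funM.
have g0 x : 0 <= f x / a by rewrite divr_ge0.
pose nu0 := dens mu mg g0.
have nuT : nu0 setT = 1%E.
  rewrite /nu0 -[LHS]/(\int[mu]_x (f x / a)%:E)%E.
  rewrite (_ : (\int[mu]_x _)%E = (\int[mu]_x ((a)^-1%:E * (f x)%:E))%E); last first.
    by apply: eq_integral => x _; rewrite -!EFinM; congr EFin; ring.
  rewrite ge0_integralZl_EFin ?invr_ge0//.
  by rewrite expectE// -EFinM mulVf.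
pose nu1 := Measure_isProbability.Build _ _ _ nu0 nuT.
pose nu : probability T R := HB.pack nu0 nu1.
have nuE (g : T -> \bar R) : measurable_fun setT g -> (forall x, 0 <= g x)%E ->
    (\int[nu]_x g x = \int[mu]_x ((f x / a)%:E * g x))%E.
  by move=> mg' g'0; rewrite -[LHS]/(\int[nu0]_x g x)%E integral_dens.
have W1nu := W1_density_le bf a_gt0 nuE; rewrite -/a -/M in W1nu.
have mfX r : measurable_fun setT (fun w => f (X r w)).
  by apply: measurableT_comp => //; exact: mX.
pose m1 := dens Pr (mfX s) (fun w => f0 (X s w)).
have LHSE : (\int[Pr]_w (f (X s w) * f (X (s + t)%R w))%:E =
    \int[pushforward m1 (X (s + t)%R)]_x (f x)%:E)%E.
  rewrite ge0_integral_pushforward// ?preimage_setT ?integral_dens//; last 2 first.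
  - exact/measurable_EFinP.
  - by move=> x; rewrite lee_fin.
(* Under the measure of density [f (X s)] with respect to [Pr], the law of [X (s + t)] is [a] times
   [nu P_t]. *)
have m1E A : measurable A -> pushforward m1 (X (s + t)) A = (a%:E * mker nu (P t) A)%E.
  move=> mA; rewrite -[LHS]/(\int[Pr]_(w in X (s + t)%R @^-1` A) (f (X s w))%:E)%E.
  rewrite markov_joint_integral// /mker nuE//; last exact: measurable_kernel.
  rewrite -ge0_integralZl_EFin//; last 2 first.
  - by move=> x _; rewrite mule_ge0// lee_fin.
  - by apply: emeasurable_funM; [exact/measurable_EFinP|exact: measurable_kernel].
  apply: eq_integral => x _; rewrite muleA -EFinM; congr (_%:E * _)%E.
  by rewrite mulrC divfK.
set l := (\int[Pr]_w _)%E in LHSE *.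
have l_ge0 : (0 <= l)%E.
  by apply: integral_ge0 => w _; rewrite lee_fin mulr_ge0.
have l_fin : l \is a fin_num.
  rewrite ge0_fin_numE//; apply: (@le_lt_trans _ _ (\int[Pr]_w (1:R)%:E)%E).
    apply: ge0_le_integralT => w; rewrite lee_fin ?mulr_ge0//.
    have /andP[? ?] := f01 (X s w); have /andP[? ?] := f01 (X (s + t) w).
    by rewrite mulr_ile1.
  by rewrite integral_cst//= probability_setT mul1e ltry.
have key : (((fine l - a ^+ 2) / (a * K))%:E <= W1 (mker nu (P t)) (mker mu (P t)))%E.
  apply: le_ereal_inf_tmp => _ [pi [cpi ->]].
  (* [mker nu (P t)] is a bare set function, so the first marginal of [pi], scaled by [a], is
     compared with [pushforward m1] set by set. *)
  have lE : l = (a%:E * \int[pi]_z (f z.1)%:E)%E.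
    have ma : measurable_fun setT (fun _ : T * T => a) by [].
    rewrite LHSE -ge0_integralZl_EFin//; last first.
      by apply/measurable_EFinP; exact: measurableT_comp.
    transitivity (\int[pushforward (dens pi ma (fun=> a0)) fst]_x (f x)%:E)%E; last first.
      rewrite (ge0_integral_pushforwardT _ measurable_fst mfE fE0) integral_dens//.
      by apply/measurable_EFinP; exact: measurableT_comp.
    apply: eq_measure_integral => A mA _; rewrite [LHS](m1E A mA) -(cpi A mA).1.
    transitivity (\int[pi]_(z in fst @^-1` A) a%:E)%E => //.
    have mfA : measurable (fst @^-1` A : set (T * T)).
      by rewrite -[X in measurable X]setTI; exact: measurable_fst.
    rewrite integral_cst//; congr (_ * pi _)%E.
    by apply/seteqP; split=> [z []|z Az].
  have muE : (\int[pi]_z (f z.2)%:E = a%:E)%E.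
    rewrite -expectE//.
    rewrite -(ge0_integral_pushforwardT pi measurable_snd mfE fE0).
    apply: eq_measure_integral => A mA _; rewrite -[RHS](invP t0 mA) -[RHS](cpi A mA).2.
    by rewrite /pushforward; congr (pi _); apply/seteqP; split=> [z Az|z []].
  have c0 : (0 <= \int[pi]_z ((edist z.1 z.2) `^ 1)%:E)%E.
    by apply: integral_ge0 => z _; rewrite lee_fin powR_ge0.
  have [cfin|] := boolP ((\int[pi]_z ((edist z.1 z.2) `^ 1)%:E)%E \is a fin_num); last first.
    by rewrite ge0_fin_numE// -leNgt leye_eq => /eqP ->; rewrite leey.
  rewrite -(fineK cfin) lee_fin ler_pdivrMr ?mulr_gt0// lerBlDl.
  rewrite -lee_fin fineK// lE EFinD expr2 (EFinM a a).
  have -> : (fine (\int[pi]_z ((edist z.1 z.2) `^ 1)%:E) * (a * K))%:E =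
     (a%:E * (K%:E * \int[pi]_z ((edist z.1 z.2) `^ 1)%:E))%E.
    by rewrite -[in RHS](fineK cfin) -!EFinM; congr EFin; ring.
  rewrite -ge0_muleDr; [|by rewrite lee_fin|by rewrite mule_ge0// lee_fin ltW].
  apply: lee_wpmul2l; first by rewrite lee_fin.
  rewrite -muE -ge0_integralZl_EFin//; last 3 first.
  - by move=> z _; rewrite lee_fin powR_ge0.
  - apply/measurable_EFinP; exact: (measurableT_comp (measurable_powR 1) (@measurable_edist R d)).
  - exact: ltW.
  rewrite -ge0_integralD//; last 3 first.
  - by apply/measurable_EFinP; apply: measurableT_comp.
  - by move=> z _; rewrite -EFinM lee_fin mulr_ge0 ?powR_ge0// ltW.
  - apply: emeasurable_funM => //; apply/measurable_EFinP.
    exact: (measurableT_comp (measurable_powR 1) (@measurable_edist R d)).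
  apply: ge0_le_integralT => z //; rewrite -EFinM -EFinD lee_fin.
  rewrite powRr1 ?sqrtr_ge0// -lerBlDl; apply: le_trans (Kf _ _); exact: ler_norm.
have := le_trans key (contrP nu t0).
move=> /le_trans/(_ (lee_wpmul2l _ W1nu)).
rewrite lee_fin mulr_ge0 ?expR_ge0// => /(_ isT).
rewrite -EFinM lee_fin ler_pdivrMr ?mulr_gt0// lerBlDl => H.
rewrite -(fineK l_fin) lee_fin; apply: (le_trans H).
by rewrite le_eqVlt; apply/orP; left; apply/eqP; field.
Qed.

End covariance.

(** * Mean deviation of time averages *)

Lemma integral_expR_affine (R : realType) (a b k c : R) : a < b -> k != 0 ->
  (\int[lebesgue_measure]_(s in `[a, b]) (expR (k * s + c))%:E =
   ((expR (k * b + c) - expR (k * a + c)) / k)%:E)%E.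
Proof.
move=> ab k0.
pose F := fun s : R => k^-1 * expR (k * s + c).
have dF (x : R) : is_derive x 1 F (expR (k * x + c)).
  by rewrite /F; apply: is_derive_eq; rewrite /GRing.scale/=; field.
have cF : continuous F.
  move=> x; apply: differentiable_continuous; apply/derivable1_diffP.
  by have [] := dF x.
rewrite (@continuous_FTC2 _ (fun s => expR (k * s + c)) F)//.
- by rewrite -EFinB /F; congr EFin; field.
- apply: continuous_subspaceT => x; apply: continuous_comp; last exact: continuous_expR.
  by apply: cvgD; [apply: cvgM; [exact: cvg_cst|exact: cvg_id]|exact: cvg_cst].
- split.
  + by move=> x _; have [] := dF x.
  + by apply: cvg_at_right_filter; exact: cF.
  + by apply: cvg_at_left_filter; exact: cF.
- by move=> x _; rewrite derive1E; have [_ ->] := dF x.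
Qed.

Lemma integral_exp_dist_le (R : realType) (lam T t : R) : 0 < lam -> 0 <= t <= T ->
  (\int[lebesgue_measure]_(s in `[0%R, T]) (expR (- lam * `|t - s|))%:E <= (2 / lam)%:E)%E.
Proof.
move=> l0 /andP[t0 tT].
have mE (D : set R) : measurable_fun D (fun s => (expR (- lam * `|t - s|))%:E).
  apply: measurable_funTS; apply/measurable_EFinP; apply: measurableT_comp => //.
  apply: measurable_funM => //; apply: measurableT_comp => //.
  exact: measurable_funB.
have E0 s : (0 <= (expR (- lam * `|t - s|))%:E)%E by rewrite lee_fin expR_ge0.
have exp_le1 (x : R) : x <= 0 -> expR x <= 1 by rewrite -expR0 ler_expR.
have half1 : (\int[lebesgue_measure]_(s in `[0%R, t]) (expR (- lam * `|t - s|))%:E <= (lam^-1)%:E)%E.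
  move: t0; rewrite le_eqVlt => /orP[/eqP <-|t0].
    by rewrite set_itv1 integral_set1 lee_fin invr_ge0 ltW.
  rewrite (_ : (\int[_]_(s in _) _)%E = (\int[lebesgue_measure]_(s in `[0%R, t]) (expR (lam * s + - lam * t))%:E)%E); last first.
    apply: eq_integral => s; rewrite inE/= in_itv/= => /andP[s0 st].
    by rewrite ger0_norm ?subr_ge0//; congr (expR _)%:E; ring.
  rewrite integral_expR_affine ?gt_eqF// lee_fin ler_pdivrMr// mulVf ?gt_eqF//.
  rewrite (_ : lam * t + - lam * t = 0); last by ring.
  by rewrite expR0 gerBl expR_ge0.
have half2 : (\int[lebesgue_measure]_(s in `[t, T]) (expR (- lam * `|t - s|))%:E <= (lam^-1)%:E)%E.
  move: tT; rewrite le_eqVlt => /orP[/eqP <-|tT].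
    by rewrite set_itv1 integral_set1 lee_fin invr_ge0 ltW.
  rewrite (_ : (\int[_]_(s in _) _)%E = (\int[lebesgue_measure]_(s in `[t, T]) (expR (- lam * s + lam * t))%:E)%E); last first.
    apply: eq_integral => s; rewrite inE/= in_itv/= => /andP[ts sT].
    by rewrite distrC ger0_norm ?subr_ge0//; congr (expR _)%:E; ring.
  rewrite integral_expR_affine ?oppr_eq0 ?gt_eqF// lee_fin invrN mulrN -mulNr.
  rewrite ler_pdivrMr// mulVf ?gt_eqF// opprB.
  rewrite (_ : - lam * t + lam * t = 0); last by ring.
  by rewrite expR0 gerBl expR_ge0.
have -> : `[0%R, T]%classic = `[0%R, t] `|` `]t, T] :> set R.
  by rewrite -itv_bndbnd_setU// bnd_simp.
rewrite ge0_integral_setU//; last 2 first.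
- exact: mE.
- apply/disj_setPS => s [] /=; rewrite !in_itv/= => /andP[_ st] /andP[ts _].
  by move: (lt_le_trans ts st); rewrite ltxx.
rewrite integral_itv_obnd_cbnd; last exact: mE.
have -> : 2 / lam = lam^-1 + lam^-1 by field; rewrite gt_eqF.
by rewrite EFinD leeD.
Qed.

(* [uniform_prob] lives on the display of the Lebesgue measure; this is the same
   measure on the default Borel structure of [R]. *)
Definition unif (R : realType) (T : R) (T0 : 0 < T) (A : set R) : \bar R :=
  uniform_prob T0 A.

Section unif.
Context (R : realType) (T : R) (T0 : 0 < T).

Let unif_sigma_additive : semi_sigma_additive (unif T0).
Proof.
by move=> F mF tF mUF; exact: (@measure_semi_sigma_additive _ _ _ (uniform_prob T0)).
Qed.

HB.instance Definition _ := isMeasure.Build _ _ _ (unif T0)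
  (measure0 (uniform_prob T0)) (measure_ge0 (uniform_prob T0)) unif_sigma_additive.

Let unif_setT : unif T0 setT = 1%E.
Proof. exact: (probability_setT (uniform_prob T0)). Qed.

HB.instance Definition _ := Measure_isProbability.Build _ _ _ (unif T0) unif_setT.

End unif.

Lemma measurable_on_lebesgue (R : realType) d (T : measurableType d) (f : R -> T) :
  measurable_fun setT f -> measurable_fun (setT : set (measurableTypeR R)) f.
Proof. by move=> mf _ Y mY; exact: (mf measurableT Y mY). Qed.

Lemma integral_unif (R : realType) (T : R) (T0 : 0 < T) (f : R -> \bar R) :
  measurable_fun setT f -> (forall x, 0 <= f x)%E ->
  (\int[unif T0]_x f x = (T^-1)%:E * \int[lebesgue_measure]_(x in `[0%R, T]) f x)%E.
Proof.
move=> mf f0; have mi : measurable_fun (setT : set (measurableTypeR R)) (fun x => x : R).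
  exact: (measurable_on_lebesgue (@measurable_id _ _ _)).
have := integral_uniform T0 (measurable_on_lebesgue mf) f0.
rewrite subr0 => <-.
exact: (ge0_integral_pushforwardT (uniform_prob T0) mi mf f0).
Qed.

Lemma ge0_le_uniform (R : realType) (T : R) (T0 : 0 < T) (f g : R -> \bar R) :
  measurable_fun setT f -> measurable_fun setT g ->
  (forall x, 0 <= f x)%E -> (forall x, 0 <= g x)%E ->
  (forall x, 0 <= x <= T -> (f x <= g x)%E) ->
  (\int[unif T0]_x f x <= \int[unif T0]_x g x)%E.
Proof.
move=> mf mg f0 g0 fg; rewrite !integral_unif//.
apply: lee_wpmul2l; first by rewrite lee_fin invr_ge0 ltW.
apply: ge0_le_integral => //.
- exact: (measurable_funTS (measurable_on_lebesgue mf)).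
- exact: (measurable_funTS (measurable_on_lebesgue mg)).
Qed.

Lemma uniform_exp_dist_le (R : realType) (T lam t : R) (T0 : 0 < T) : 0 < lam ->
  0 <= t <= T ->
  (\int[unif T0]_s (expR (- lam * `|t - s|))%:E <= (2 / (lam * T))%:E)%E.
Proof.
move=> l0 tT; rewrite integral_unif//.
- apply: (@le_trans _ _ ((T^-1)%:E * (2 / lam)%:E)%E).
    by apply: lee_wpmul2l; rewrite ?integral_exp_dist_le// lee_fin invr_ge0 ltW.
  by rewrite -EFinM lee_fin le_eqVlt; apply/orP; left; apply/eqP; field; rewrite !gt_eqF.
- apply/measurable_EFinP; apply: measurableT_comp => //.
  by apply: measurable_funM => //; apply: measurableT_comp => //; apply: measurable_funB.
Qed.

Section variance.
Context (R : realType) (d : nat) (dO : measure_display) (Omega : measurableType dO).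
Context (Pr : probability Omega R).
Local Notation T := (d.-tuple R).
Context (X : R -> Omega -> T) (P : R -> R.-pker T ~> T) (mu : probability T R).
Context (C lamE : R).
Hypothesis invP : is_invariant P mu.
Hypothesis markX : is_markov_process Pr X P mu.
Hypothesis C0 : 0 <= C.
Hypothesis lam0 : 0 < lamE.
Hypothesis contrP : forall (nu : probability T R) (t : R), 0 <= t ->
     (W1 (mker nu (P t)) (mker mu (P t)) <=
      (C * expR (- lamE * t))%:E * W1 nu mu)%E.
Context (W : T -> R).
Hypothesis mW : measurable_fun setT W.
Hypothesis W_enorm : forall x, (\int[mu]_y (enorm y)%:E + (enorm x)%:E <= (W x)%:E)%E.
Hypothesis W_int : (\int[mu]_x (W x)%:E < +oo)%E.
Context (Tm : R) (Tm0 : 0 < Tm).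

Let lT := unif Tm0.
Let mX : measurable_fun setT (fun z : R * Omega => X z.1 z.2).
Proof. by case: markX. Qed.

Lemma measurable_path w : measurable_fun setT (fun t : R => X t w).
Proof. exact: (measurableT_comp mX (measurable_pair2 w)). Qed.

Definition time_average (f : T -> R) (w : Omega) : R :=
  expect lT (fun t : R => f (X t w)).

Section one_function.
Context (f : T -> R).
Hypothesis bf : bounded01 f.

Let f0 x : 0 <= f x. Proof. by case: bf => _ /(_ x)/andP[]. Qed.
Let mfX : measurable_fun setT (fun z : R * Omega => f (X z.1 z.2)).
Proof. by apply: (measurableT_comp _ mX); case: bf. Qed.

Let bpath w : bounded01 (fun t : R => f (X t w)).
Proof.
split=> [|t]; last by case: bf.
by apply: (measurableT_comp _ (measurable_path w)); case: bf.
Qed.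

Lemma time_averageE w :
  (\int[lT]_t (f (X t w))%:E = (time_average f w)%:E)%E.
Proof. exact: expectE (bpath w). Qed.

Lemma measurable_time_average : measurable_fun setT (time_average f).
Proof.
apply/measurable_EFinP.
rewrite (_ : _ \o _ = fun w => (\int[lT]_t (f (X t w))%:E)%E); last first.
  by apply/funext => w /=; rewrite time_averageE.
apply: (@measurable_fun_fubini_tonelli_G _ _ _ _ _ lT (fun z => (f (X z.1 z.2))%:E)).
- exact/measurable_EFinP.
- by move=> z; rewrite lee_fin.
Qed.

Lemma time_average01 w : 0 <= time_average f w <= 1.
Proof.
rewrite expect_ge0//= -(expect1 lT); apply: expect_le => //.
- by split=> // t; rewrite ler01 lexx.
- by move=> t; case: bf => _ /(_ (X t w))/andP[].
Qed.

(** By Tonelli, since each [X t] with [t >= 0] has law [mu]. *)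
Lemma mean_time_average (g : T -> \bar R) : measurable_fun setT g ->
  (forall x, 0 <= g x)%E ->
  (\int[Pr]_w \int[lT]_t g (X t w) = \int[mu]_x g x)%E.
Proof.
move=> mg g0.
have mgX : measurable_fun setT (fun z : R * Omega => g (X z.1 z.2)).
  exact: (measurableT_comp mg mX).
rewrite -(@fubini_tonelli _ _ _ _ _ lT Pr (fun z => g (X z.1 z.2)))//.
have g1 : (0 <= \int[mu]_x g x)%E by apply: integral_ge0.
have mG := @measurable_fun_fubini_tonelli_F _ _ _ _ _ Pr _ mgX (fun z => g0 _).
rewrite integral_unif//; last by move=> t; apply: integral_ge0.
rewrite (eq_integral (fun=> \int[mu]_x g x)%E); last first.
  move=> t; rewrite inE/= in_itv/= => /andP[t0 _].
  by rewrite (integral_marginal invP markX t0 mg g0).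
rewrite integral_cst//= lebesgue_measure_itv/= lte_fin Tm0 -EFinD subr0.
by rewrite muleCA -EFinM mulVf ?gt_eqF// mule1.
Qed.

(** The square is a double time average of [f (X s) f (X t)], obtained by applying Tonelli twice and
    expanding one factor at a time. For fixed [t] the exponential decay averages over [s] to at most
    [2 / (lamE * Tm)]. *)
Lemma mean_square_time_average (K : R) : 0 < K -> edist_lipschitz K f ->
  (\int[Pr]_w (time_average f w * time_average f w)%:E <=
   (expect mu f ^+ 2 + 2 * K * d%:R * C / (lamE * Tm) *
     expect mu (fun x => (f x * W x)%R))%:E)%E.
Proof.
move=> K0 Kf.
set a := expect mu f; set M := expect mu (fun x => _).
have W0 x : 0 <= W x.
  rewrite -lee_fin (le_trans _ (W_enorm x))// adde_ge0 ?lee_fin ?sqrtr_ge0//.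
  by apply: integral_ge0 => y _; rewrite lee_fin sqrtr_ge0.
have M0 : 0 <= M by apply: expect_ge0 => x; rewrite mulr_ge0.
pose B := K * d%:R * C * M.
have B0 : 0 <= B by rewrite !mulr_ge0// ltW.
have cov s t : 0 <= s -> 0 <= t ->
    (\int[Pr]_w (f (X s w) * f (X t w))%:E <= (a ^+ 2)%:E + B%:E * (expR (- lamE * `|t - s|))%:E)%E.
  wlog st : s t / s <= t.
    move=> H s0 t0; case: (leP s t) => [/H|/ltW/H]; first exact.
    move=> /(_ t0 s0); rewrite distrC; apply: le_trans.
    by under eq_integral do rewrite mulrC.
  move=> s0 t0; rewrite ger0_norm ?subr_ge0// -EFinM -EFinD.
  have := covariance_le invP markX C0 contrP mW W_enorm W_int bf K0 Kf s0 (_ : 0 <= t - s).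
  rewrite subr_ge0 addrC subrK => /(_ st) /le_trans; apply.
  by rewrite lee_fin /B lerD2l le_eqVlt; apply/orP; left; apply/eqP; rewrite -/M; ring.
have mA := measurable_time_average.
have A0 w : 0 <= time_average f w by case/andP: (time_average01 w).
pose h (z : R * Omega) := (time_average f z.2 * f (X z.1 z.2))%:E.
have mh : measurable_fun setT h.
  by apply/measurable_EFinP; apply: measurable_funM => //; exact: measurableT_comp.
have h0 z : (0 <= h z)%E by rewrite lee_fin mulr_ge0.
have -> : (\int[Pr]_w (time_average f w * time_average f w)%:E =
    \int[Pr]_w \int[lT]_t h (t, w))%E.
  apply: eq_integral => w _; rewrite /h/=.
  under eq_integral do rewrite EFinM.
  rewrite ge0_integralZl_EFin//.
  - by rewrite time_averageE.
  - by move=> t _; rewrite lee_fin.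
  - by apply/measurable_EFinP; case: (bpath w).
rewrite -(@fubini_tonelli _ _ _ _ _ lT Pr h mh h0).
have mexp t : measurable_fun setT (fun s : R => (expR (- lamE * `|t - s|))%:E).
  apply/measurable_EFinP; apply: measurableT_comp => //.
  by apply: measurable_funM => //; apply: measurableT_comp => //; apply: measurable_funB.
have mexp2 t : measurable_fun setT (fun s : R => ((a ^+ 2)%:E + B%:E * (expR (- lamE * `|t - s|))%:E)%E).
  by apply: emeasurable_funD => //; apply: emeasurable_funM.
have inner t : 0 <= t <= Tm ->
    (\int[Pr]_w h (t, w) <= (a ^+ 2 + B * (2 / (lamE * Tm)))%:E)%E.
  move=> tT; have /andP[t0 _] := tT.
  pose k (z : R * Omega) := (f (X z.1 z.2) * f (X t z.2))%:E.
  have mft : measurable_fun setT (fun w => f (X t w)).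
    exact: (measurableT_comp mfX (measurable_pair1 t)).
  have mk : measurable_fun setT k.
    apply/measurable_EFinP; apply: measurable_funM => //.
    exact: (measurableT_comp mft measurable_snd).
  have k0 z : (0 <= k z)%E by rewrite lee_fin mulr_ge0.
  have -> : (\int[Pr]_w h (t, w) = \int[Pr]_w \int[lT]_s k (s, w))%E.
    apply: eq_integral => w _; rewrite /k /h/=.
    under eq_integral do rewrite mulrC EFinM.
    rewrite ge0_integralZl_EFin//.
    - by rewrite time_averageE -EFinM mulrC.
    - by move=> s _; rewrite lee_fin.
    - by apply/measurable_EFinP; case: (bpath w).
  rewrite -(@fubini_tonelli _ _ _ _ _ lT Pr k mk k0).
  apply: (@le_trans _ _ (\int[lT]_s ((a ^+ 2)%:E + B%:E * (expR (- lamE * `|t - s|))%:E))%E).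
    apply: ge0_le_uniform => //.
    - exact: (@measurable_fun_fubini_tonelli_F _ _ _ _ _ Pr k mk k0).
    - by move=> s; apply: integral_ge0 => w _.
    - by move=> s; rewrite -EFinM -EFinD lee_fin addr_ge0 ?sqr_ge0// mulr_ge0 ?expR_ge0.
    - by move=> s /andP[s0 _]; exact: cov.
  rewrite ge0_integralD//; last 3 first.
  - by move=> s _; rewrite lee_fin sqr_ge0.
  - by move=> s _; rewrite -EFinM lee_fin mulr_ge0 ?expR_ge0.
  - exact: emeasurable_funM.
  rewrite integral_cst//= probability_setT mule1 EFinD leeD2l//.
  rewrite ge0_integralZl_EFin//.
  rewrite (EFinM B); apply: lee_wpmul2l; first by rewrite lee_fin.
  exact: uniform_exp_dist_le.
apply: (@le_trans _ _ (\int[lT]_t (a ^+ 2 + B * (2 / (lamE * Tm)))%:E)%E).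
  apply: ge0_le_uniform => //.
  - exact: (@measurable_fun_fubini_tonelli_F _ _ _ _ _ Pr h mh h0).
  - by move=> s; apply: integral_ge0 => w _.
  - move=> s; rewrite lee_fin addr_ge0 ?sqr_ge0//.
    by rewrite mulr_ge0// divr_ge0// mulr_ge0// ltW.
rewrite integral_cst//= probability_setT mule1 lee_fin /B lerD2l.
by rewrite le_eqVlt; apply/orP; left; apply/eqP; field; rewrite !gt_eqF.
Qed.

(** This bound is linear in the mean of [f]. It serves the cells in the tails, which are too
    numerous to carry a term that does not shrink with their weight, and the cells of weight 0. *)
Lemma mean_abs_deviation_trivial :
  (\int[Pr]_w (`|time_average f w - expect mu f|)%:E <= (2 * expect mu f)%:E)%E.
Proof.
have mA := measurable_time_average.
have A0 w : 0 <= time_average f w by case/andP: (time_average01 w).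
have a0 : 0 <= expect mu f by exact: expect_ge0.
have EA : (\int[Pr]_w (time_average f w)%:E = (expect mu f)%:E)%E.
  under eq_integral do rewrite -time_averageE.
  rewrite (@mean_time_average (fun x => (f x)%:E)) ?expectE//.
  by apply/measurable_EFinP; case: bf.
apply: (@le_trans _ _ (\int[Pr]_w ((time_average f w)%:E + (expect mu f)%:E))%E).
  apply: ge0_le_integralT => w; first by rewrite lee_fin.
  by rewrite -EFinD lee_fin (le_trans (ler_normB _ _))// !ger0_norm.
rewrite ge0_integralD//; last 2 first.
- by move=> w _; rewrite lee_fin.
- exact/measurable_EFinP.
rewrite EA integral_cst//= probability_setT mule1 -EFinD lee_fin.
by rewrite le_eqVlt; apply/orP; left; apply/eqP; ring.
Qed.

(** The inequality [|z| <= kap + z^2 / kap] stands in for Cauchy-Schwarz; the free parameter [kap]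
    will be taken proportional to the weight of the cell. *)
Lemma mean_abs_deviation_le (K kap : R) : 0 < K -> edist_lipschitz K f -> 0 < kap ->
  (\int[Pr]_w (`|time_average f w - expect mu f|)%:E <=
   (kap + 2 * K * d%:R * C / (lamE * Tm) *
     expect mu (fun x => (f x * W x)%R) / kap)%:E)%E.
Proof.
move=> K0 Kf kap0.
set a := expect mu f; set V := _ * expect mu _.
have mA := measurable_time_average.
have A0 w : 0 <= time_average f w by case/andP: (time_average01 w).
have a0 : 0 <= a by exact: expect_ge0.
have EA : (\int[Pr]_w (time_average f w)%:E = a%:E)%E.
  under eq_integral do rewrite -time_averageE.
  rewrite (@mean_time_average (fun x => (f x)%:E)) ?expectE//.
  by apply/measurable_EFinP; case: bf.
have mZ : measurable_fun setT (fun w => (time_average f w - a) ^+ 2).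
  by apply: measurable_funX; apply: measurable_funB.
pose Z2 := (\int[Pr]_w ((time_average f w - a) ^+ 2)%:E)%E.
have Z2le : (Z2 <= V%:E)%E.
  (* With [A] the time average, [(A - a)^2 + 2 a A = A^2 + a^2]; moving the cross term to the left
     keeps every integrand nonnegative. *)
  have : (Z2 + (2 * a * a)%:E <= (a ^+ 2 + V)%:E + (a ^+ 2)%:E)%E.
    have -> : (Z2 + (2 * a * a)%:E = \int[Pr]_w (((time_average f w - a) ^+ 2)%:E + (2 * a)%:E * (time_average f w)%:E))%E.
      rewrite ge0_integralD//; last 4 first.
      - by move=> w _; rewrite lee_fin sqr_ge0.
      - exact/measurable_EFinP.
      - by move=> w _; rewrite -EFinM lee_fin !mulr_ge0.
      - by apply: emeasurable_funM => //; exact/measurable_EFinP.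
      rewrite ge0_integralZl_EFin ?mulr_ge0//; last 2 first.
      - by move=> w _; rewrite lee_fin.
      - exact/measurable_EFinP.
      by rewrite EA.
    have -> : (\int[Pr]_w (((time_average f w - a) ^+ 2)%:E + (2 * a)%:E * (time_average f w)%:E) =
        \int[Pr]_w ((time_average f w * time_average f w)%:E + (a ^+ 2)%:E))%E.
      by apply: eq_integral => w _; rewrite -!EFinM -!EFinD; congr EFin; ring.
    rewrite ge0_integralD//; last 3 first.
    - by move=> w _; rewrite lee_fin mulr_ge0.
    - by apply/measurable_EFinP; exact: measurable_funM.
    - by move=> w _; rewrite lee_fin sqr_ge0.
    rewrite integral_cst//= probability_setT mule1 leeD2r//.
    exact: mean_square_time_average.
  have -> : ((a ^+ 2 + V)%:E + (a ^+ 2)%:E = V%:E + (2 * a * a)%:E)%E.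
    by rewrite -!EFinD; congr EFin; ring.
  by rewrite leeD2rE.
apply: (@le_trans _ _ (\int[Pr]_w (kap%:E + (kap^-1)%:E * ((time_average f w - a) ^+ 2)%:E))%E).
  apply: ge0_le_integralT => w; first by rewrite lee_fin.
  rewrite -EFinM -EFinD lee_fin.
  rewrite -(ler_pM2l kap0) mulrDr mulVKf ?gt_eqF// -[X in _ <= _ + X]real_normK ?num_real//.
  set u := `|_|; nra.
rewrite ge0_integralD//; last 3 first.
- by move=> w _; rewrite lee_fin ltW.
- by move=> w _; rewrite -EFinM lee_fin mulr_ge0 ?sqr_ge0// invr_ge0 ltW.
- by apply: emeasurable_funM => //; exact/measurable_EFinP.
rewrite integral_cst//= probability_setT mule1 EFinD leeD2l//.
have ki : 0 <= kap^-1 by rewrite invr_ge0 ltW.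
rewrite ge0_integralZl_EFin//; last 2 first.
- by move=> w _; rewrite lee_fin sqr_ge0.
- exact/measurable_EFinP.
by rewrite (mulrC V) EFinM; apply: lee_wpmul2l; rewrite ?lee_fin.
Qed.

End one_function.
End variance.

(** * The dyadic partition of unity *)

Lemma norm_prodB_le (R : realDomainType) (I : Type) (r : seq I) (a b : I -> R) :
  (forall i, 0 <= a i <= 1) -> (forall i, 0 <= b i <= 1) ->
  `|\prod_(i <- r) a i - \prod_(i <- r) b i| <= \sum_(i <- r) `|a i - b i|.
Proof.
move=> a01 b01; elim: r => [|i r IH]; first by rewrite !big_nil subrr normr0.
have p01 (c : I -> R) : (forall i, 0 <= c i <= 1) -> 0 <= \prod_(i <- r) c i <= 1.
  move=> c01; rewrite prodr_ge0 => [|j _]; last by case/andP: (c01 j).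
  by apply: prodr_ile1 => j _.
rewrite !big_cons.
have /andP[pa0 pa1] := p01 a a01; have /andP[b0 b1] := b01 i.
set A := \prod_(j <- r) a j in pa0 pa1 IH *; set B := \prod_(j <- r) b j in IH *.
have -> : a i * A - b i * B = (a i - b i) * A + b i * (A - B) by ring.
rewrite (le_trans (ler_normD _ _))// lerD//.
  by rewrite normrM ler_piMr// ger0_norm.
by rewrite normrM (ger0_norm b0) (le_trans _ IH)// ler_piMl.
Qed.

Section dyadic_partition.
Context (R : realType) (d L : nat) (eps : R).
Hypothesis eps0 : 0 < eps.
Local Notation M := (2 ^ L.+1)%N.
Local Notation T := (d.-tuple R).

(* The end values [1] and [0] let the two extreme cells absorb the tails of the line. *)
Definition ramp (k : nat) (t : R) : R :=
  if k == 0%N then 1 else if (M <= k)%N then 0 else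
  Num.min 1 (Num.max 0 (t / eps + 2 ^+ L - k%:R)).

(** In the coordinate [u = t / eps + 2 ^+ L] an interior ramp rises from 0 to 1 on [[k, k + 1]], so
    an interior hat is the tent function on [[j, j + 2]]. The origin [t = 0] is [u = 2 ^+ L], the
    middle of the [M] cells. *)
Definition hat (j : nat) (t : R) : R := ramp j t - ramp j.+1 t.

Let M0 : (0 < M)%N. Proof. by rewrite expn_gt0. Qed.

Lemma clamp01 (u : R) : 0 <= Num.min 1 (Num.max 0 u) <= 1.
Proof. by rewrite le_min ler01 le_max lexx/= ge_min lexx. Qed.

Lemma clamp_mono (u v : R) : u <= v ->
  Num.min 1 (Num.max 0 u) <= Num.min 1 (Num.max 0 v).
Proof. by move=> uv; rewrite /Num.min /Num.max; do 4 case: ifP => //; lra. Qed.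

Lemma clamp_lip (u v : R) :
  `|Num.min 1 (Num.max 0 u) - Num.min 1 (Num.max 0 v)| <= `|u - v|.
Proof.
wlog uv : u v / v <= u.
  move=> H; case: (leP v u) => [/H//|/ltW/H].
  by rewrite distrC [X in _ <= X -> _]distrC.
rewrite !ger0_norm ?subr_ge0 ?clamp_mono//.
by rewrite /Num.min /Num.max; do 4 case: ifP => //; lra.
Qed.

Lemma ramp01 k t : 0 <= ramp k t <= 1.
Proof.
rewrite /ramp; case: ifP => _; first by rewrite ler01 lexx.
by case: ifP => _; [rewrite lexx ler01|exact: clamp01].
Qed.

Lemma ramp_anti k k' t : (k <= k')%N -> ramp k' t <= ramp k t.
Proof.
move=> kk; have /andP[r0 r1] := ramp01 k t; have /andP[r0' r1'] := ramp01 k' t.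
rewrite {2}/ramp; case: ifP => // k0; case: ifP => Mk.
  by rewrite /ramp (leq_trans Mk kk) -leqn0 leqNgt (leq_trans _ kk)// lt0n k0.
rewrite /ramp -leqn0 leqNgt (leq_trans _ kk) ?lt0n ?k0//=.
case: ifP => _; first by case/andP: (clamp01 (t / eps + 2 ^+ L - k%:R)).
by apply: clamp_mono; rewrite lerD2l lerN2 ler_nat.
Qed.

Lemma ramp_lip k t t' : `|ramp k t - ramp k t'| <= `|t - t'| / eps.
Proof.
have e0 : 0 <= `|t - t'| / eps by rewrite divr_ge0// ltW.
rewrite /ramp; case: ifP => _; first by rewrite subrr normr0.
case: ifP => _; first by rewrite subrr normr0.
apply: (le_trans (clamp_lip _ _)).
rewrite -[in X in _ <= X](gtr0_norm eps0) -normf_div le_eqVlt; apply/orP; left; apply/eqP; congr `|_|.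
by field; rewrite gt_eqF.
Qed.

Lemma measurable_ramp k : measurable_fun setT (ramp k).
Proof.
rewrite /ramp; case: (k == 0%N); first exact: measurable_cst.
case: (M <= k)%N; first exact: measurable_cst.
apply: measurable_minr => //; apply: measurable_maxr => //.
by apply: measurable_funB => //; apply: measurable_funD => //; exact: measurable_funM.
Qed.

Lemma hat_ge0 j t : 0 <= hat j t.
Proof. by rewrite subr_ge0 ramp_anti. Qed.

Lemma hat_out j t : (M <= j)%N -> hat j t = 0.
Proof.
move=> Mj; have r k : (M <= k)%N -> ramp k t = 0.
  by move=> Mk; rewrite /ramp Mk; case: eqP => // k0; move: Mk; rewrite k0 leqNgt M0.
by rewrite /hat !r ?subrr// (leq_trans Mj).
Qed.

Lemma sum_hat (a b : nat) t : (a <= b)%N ->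
  \sum_(a <= j < b) hat j t = ramp a t - ramp b t.
Proof.
move=> ab; rewrite -[LHS]opprK -sumrN.
rewrite (eq_bigr (fun j => ramp j.+1 t - ramp j t)); last by move=> j _; rewrite opprB.
by rewrite telescope_sumr// opprB.
Qed.

Lemma sum_hat_all t : \sum_(j < M) hat j t = 1.
Proof.
rewrite -(big_mkord xpredT (fun j => hat j t)) sum_hat// /ramp eqxx leqnn.
by case: eqP => [MM|_]; [have := M0; rewrite MM|rewrite subr0].
Qed.

(** The restriction on [t] is essential: outside the window [|t| < 2 ^+ L * eps] one of the two
    extreme hats is identically 1. *)
Lemma hat_support j t : hat j t != 0 -> `|t| < 2 ^+ L * eps ->
  j%:R < t / eps + 2 ^+ L < j%:R + 2.
Proof.
move=> hj tR.
have {tR}/andP[u0 uM] : 0 < t / eps + 2 ^+ L < M%:R.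
  move: tR; rewrite -ltr_pdivrMr// -[eps in `|t| / eps](gtr0_norm eps0) -normf_div ltr_norml.
  by rewrite natrX exprS => /andP[? ?]; apply/andP; split; lra.
set u := t / eps + 2 ^+ L in u0 uM *.
apply/andP; split; rewrite ltNge; apply: contra hj => ju.
  have j0 : (j == 0)%N = false.
    by apply/negbTE/eqP => j0; move: ju; rewrite j0 leNgt u0.
  have cl (k : nat) : (j <= k)%N -> Num.min 1 (Num.max 0 (u - k%:R)) = 0.
    move=> jk; have : j%:R <= k%:R :> R by rewrite ler_nat.
    by move=> ?; rewrite max_l ?min_r//; lra.
  by rewrite /hat /ramp -/u j0/= !cl// !if_same subrr.
have jM : (j.+1 < M)%N.
  by rewrite -(ltr_nat R) (le_lt_trans _ uM)// (le_trans _ ju)// -natr1; lra.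
have cl (k : nat) : (k <= j.+1)%N -> Num.min 1 (Num.max 0 (u - k%:R)) = 1.
  move=> jk; have : k%:R <= j.+1%:R :> R by rewrite ler_nat.
  rewrite -natr1 => ?.
  by rewrite max_r ?min_l//; lra.
have nM : (M <= j.+1)%N = false by rewrite leqNgt jM.
have nM' : (M <= j)%N = false by rewrite leqNgt (ltnW jM).
by rewrite /hat /ramp -/u !cl// nM nM' if_same subrr.
Qed.

Definition cell (l : nat) (j : 'I_M) : 'I_M :=
  Ordinal (leq_ltn_trans (leq_div j (2 ^ l)) (ltn_ord j)).

Definition block (l : nat) (k : 'I_M) (t : R) : R := \sum_(j | cell l j == k) hat j t.

(** A run of consecutive hats collapses to a difference of two ramps. Its slopes are therefore those
    of single ramps, and [block_lip] has the same constant at every level. *)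
Lemma block_telescope l (k : 'I_M) t :
  block l k t = ramp (k * 2 ^ l) t - ramp (k.+1 * 2 ^ l) t.
Proof.
have le_k : (k * 2 ^ l <= k.+1 * 2 ^ l)%N by rewrite leq_mul2r leqnSn orbT.
rewrite -sum_hat//.
transitivity (\sum_(0 <= j < M | (j %/ 2 ^ l == k)%N) hat j t).
  by rewrite big_mkord; apply: eq_bigl => j.
(* A block of large index may overrun [M]. The range is enlarged to contain both, at no cost since
   hats beyond [M] vanish. *)
pose N := (M + k.+1 * 2 ^ l)%N.
transitivity (\sum_(0 <= j < N | (j %/ 2 ^ l == k)%N) hat j t).
  rewrite (big_nat_widen _ _ N) ?leq_addr// big_mkcondr/=.
  apply: eq_bigr => j _; case: ltnP => // Mj; by rewrite hat_out.
rewrite [RHS](big_nat_widenl _ 0%N)// [RHS](big_nat_widen _ _ N) ?leq_addl//.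
apply: eq_bigl => j /=.
by rewrite eqn_leq leq_divRL ?expn_gt0// -ltnS ltn_divLR ?expn_gt0// andbC.
Qed.

Lemma block01 l k t : 0 <= block l k t <= 1.
Proof.
rewrite sumr_ge0 => [|j _]; last exact: hat_ge0.
rewrite block_telescope; have /andP[_ r1] := ramp01 (k * 2 ^ l) t.
by have /andP[r0 _] := ramp01 (k.+1 * 2 ^ l) t; lra.
Qed.

Lemma block_lip l k t t' : `|block l k t - block l k t'| <= 2 * (`|t - t'| / eps).
Proof.
rewrite !block_telescope.
have r1 := ramp_lip (k * 2 ^ l) t t'; have r2 := ramp_lip (k.+1 * 2 ^ l) t t'.
have -> : forall a b a' b' : R, a - b - (a' - b') = (a - a') - (b - b') by move=> *; ring.
by rewrite (le_trans (ler_normB _ _))//; lra.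
Qed.

Lemma measurable_hat j : measurable_fun setT (hat j).
Proof. by apply: measurable_funB; exact: measurable_ramp. Qed.

(** * Product functions on the grid of [R^d] and their ancestors in the dyadic tree *)

Local Notation leaf := {ffun 'I_d -> 'I_M}.

Definition tile (F : leaf) (x : T) : R := \prod_i hat (F i) (tnth x i).

Definition anc (l : nat) (F : leaf) : leaf := [ffun i => cell l (F i)].

Definition node (l : nat) (v : leaf) (x : T) : R := \prod_i block l (v i) (tnth x i).

Lemma sum_tile x : \sum_F tile F x = 1.
Proof.
rewrite /tile -(bigA_distr_bigA (fun i (j : 'I_M) => hat j (tnth x i))).
by rewrite big1// => i _; rewrite sum_hat_all.
Qed.

Lemma node_tile l v x : node l v x = \sum_(F | anc l F == v) tile F x.
Proof.
rewrite /node /block /tile.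
rewrite (bigA_distr_big_dep (fun i => [pred j | cell l j == v i]) (fun i (j : 'I_M) => hat j (tnth x i))).
apply: eq_bigl => F; apply/familyP/eqP => [H|<- i]; last by rewrite inE ffunE.
by apply/ffunP => i; rewrite ffunE; have := H i; rewrite inE => /eqP.
Qed.

Lemma measurable_tile F : measurable_fun setT (tile F).
Proof.
have mi i : measurable_fun setT (fun x : T => hat (F i) (tnth x i)).
  by apply: (measurableT_comp (measurable_hat (F i))); exact: measurable_tnth.
rewrite /tile; elim: (index_enum _) => [|i r IH].
  under eq_fun => x do rewrite big_nil.
  exact: measurable_cst.
under eq_fun => x do rewrite big_cons.
exact: measurable_funM.
Qed.

Lemma tile_ge0 F x : 0 <= tile F x.
Proof. by apply: prodr_ge0 => i _; exact: hat_ge0. Qed.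

Lemma bounded01_tile F : bounded01 (tile F).
Proof.
split=> [|x]; first exact: measurable_tile.
rewrite tile_ge0 -(sum_tile x) (bigD1 F)//= lerDl sumr_ge0// => G _.
exact: tile_ge0.
Qed.

Lemma bounded01_node l v : bounded01 (node l v).
Proof.
split=> [|x].
  rewrite (_ : node l v = (fun x => \sum_F if anc l F == v then tile F x else 0)); last first.
    by apply/funext => x; rewrite node_tile big_mkcond.
  by apply: measurable_sum => F; case: (anc l F == v) => //; exact: measurable_tile.
rewrite node_tile sumr_ge0 => [|F _]; last exact: tile_ge0.
rewrite -(sum_tile x) [X in _ <= X](bigID (fun F => anc l F == v))/= lerDl.
by apply: sumr_ge0 => F _; exact: tile_ge0.
Qed.

Lemma node_lip l v : edist_lipschitz (2 * d%:R / eps) (node l v).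
Proof.
move=> x y; rewrite /node.
apply: (le_trans (norm_prodB_le _ _ _)).
- by move=> i; exact: block01.
- by move=> i; exact: block01.
apply: (@le_trans _ _ (\sum_(i < d) 2 * (edist x y / eps))).
  apply: ler_sum => i _; apply: (le_trans (block_lip _ _ _ _)).
  by rewrite ler_pM2l// ler_pM2r ?invr_gt0// coord_le_edist.
by rewrite sumr_const card_ord -[X in X <= _]mulr_natl le_eqVlt; apply/orP; left; apply/eqP; ring.
Qed.

Lemma cellS l (j j' : 'I_M) : cell l j = cell l j' -> cell l.+1 j = cell l.+1 j'.
Proof.
move=> /(congr1 val)/= H; apply: val_inj => /=.
by have := congr1 (fun n => n %/ 2)%N H; rewrite -!divnMA -expnSr.
Qed.

Lemma ancS l F G : anc l F = anc l G -> anc l.+1 F = anc l.+1 G.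
Proof.
move=> /ffunP H; apply/ffunP => i; rewrite !ffunE.
by apply: cellS; have := H i; rewrite !ffunE.
Qed.

Lemma anc_top F G : anc L.+1 F = anc L.+1 G.
Proof.
apply/ffunP => i; rewrite !ffunE; apply: val_inj => /=.
by rewrite !divn_small.
Qed.

(** In units of [eps] the points lie between 0 and 2 above [j] and [j'], and these differ by at most
    [2 ^ l - 1]; the total is at most [2 ^ l + 1 <= 2 * 2 ^ l]. *)
Lemma hat_dist l (j j' : 'I_M) t t' : cell l j = cell l j' ->
  hat j t != 0 -> hat j' t' != 0 ->
  `|t| < 2 ^+ L * eps -> `|t'| < 2 ^+ L * eps -> `|t - t'| <= 2 * (2 ^+ l * eps).
Proof.
move=> jj hj hj' tR tR'.
have /andP[a1 a2] := hat_support hj tR; have /andP[b1 b2] := hat_support hj' tR'.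
have H1 : (j < j' + 2 ^ l)%N.
  have /(congr1 val)/= E := jj.
  rewrite (divn_eq j (2 ^ l)) E {2}(divn_eq j' (2 ^ l)) -addnA ltn_add2l.
  by rewrite (leq_trans (ltn_pmod _ _)) ?expn_gt0// leq_addl.
have H2 : (j' < j + 2 ^ l)%N.
  have /(congr1 val)/= E := jj.
  rewrite (divn_eq j' (2 ^ l)) -E {2}(divn_eq j (2 ^ l)) -addnA ltn_add2l.
  by rewrite (leq_trans (ltn_pmod _ _)) ?expn_gt0// leq_addl.
have h1 : j%:R + 1 <= j'%:R + 2 ^+ l :> R by rewrite natr1 -natrX -natrD ler_nat.
have h2 : j'%:R + 1 <= j%:R + 2 ^+ l :> R by rewrite natr1 -natrX -natrD ler_nat.
have e1 : 1 <= 2 ^+ l :> R by rewrite exprn_ege1// ler1n.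
rewrite mulrA -ler_pdivrMr// -[eps in `|_| / eps](gtr0_norm eps0) -normf_div mulrBl ler_norml.
by apply/andP; split; lra.
Qed.

(** If some coordinate leaves the window, its point has norm at least [rad], and this norm also
    dominates the coordinates that stay inside. Hence the distance is at most [2 d] times the
    largest of the cell size and the norms [h x], [h y], where [h] ignores points of norm below
    [rad]; beyond [rad], [|z|^p <= rad^(p - q) |z|^q]. *)
Lemma tile_cost (p q : R) l F G x y : 0 < p -> p < q ->
  tile F x != 0 -> tile G y != 0 -> anc l F = anc l G ->
  edist x y `^ p <= (2 * d%:R) `^ p *
    ((2 ^+ l * eps) `^ p +
     (2 ^+ L * eps) `^ (p - q) * (enorm x `^ q + enorm y `^ q)).
Proof.
move=> p0 pq Fx Gy FG.
set rad := 2 ^+ L * eps; set s := 2 ^+ l * eps.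
have rad0 : 0 < rad by rewrite mulr_gt0// exprn_gt0.
have s0 : 0 < s by rewrite mulr_gt0// exprn_gt0.
pose h (z : T) := if rad <= enorm z then enorm z else 0.
have h0 z : 0 <= h z by rewrite /h; case: ifP => // _; rewrite sqrtr_ge0.
have hp z : h z `^ p <= rad `^ (p - q) * enorm z `^ q.
  rewrite /h; case: ifP => [rz|_]; last by rewrite powR0 ?gt_eqF// mulr_ge0 ?powR_ge0.
  have z0 : 0 < enorm z by exact: lt_le_trans rz.
  have -> : p = (p - q) + q by ring.
  rewrite [in X in X <= _]powRD ?(gt_eqF z0) ?implybT// addrK ler_wpM2r ?powR_ge0//.
  rewrite -[p - q]opprB !powRN lef_pV2 ?posrE ?powR_gt0//.
  by apply: ge0_ler_powR; rewrite ?nnegrE ?subr_ge0//; exact: ltW.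
have hz (z : T) i : rad <= `|tnth z i| -> `|tnth z i| <= h z.
  by move=> rz; rewrite /h (le_trans rz) ?coord_le_enorm.
pose D := Num.max s (Num.max (h x) (h y)).
have D0 : 0 <= D by rewrite le_max ltW.
have dD : edist x y <= d%:R * (2 * D).
  apply: edist_coord_le => [|i]; first by rewrite mulr_ge0.
  have hF : hat (F i) (tnth x i) != 0 by move: Fx; apply: contraNneq => E; rewrite /tile (bigD1 i)//= E mul0r.
  have hG : hat (G i) (tnth y i) != 0 by move: Gy; apply: contraNneq => E; rewrite /tile (bigD1 i)//= E mul0r.
  have cFG : cell l (F i) = cell l (G i) by have /ffunP/(_ i) := FG; rewrite !ffunE.
  have sD : s <= D by rewrite le_max lexx.
  have xD : h x <= D by rewrite !le_max lexx orbT.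
  have yD : h y <= D by rewrite !le_max lexx !orbT.
  have tri := ler_normB (tnth x i) (tnth y i).
  case: (ltP `|tnth x i| rad) => [xr|/[dup] rx /hz hx].
    case: (ltP `|tnth y i| rad) => [yr|/[dup] ry /hz hy].
      by apply: (le_trans (hat_dist cFG hF hG xr yr)); rewrite ler_pM2l.
    by lra.
  case: (ltP `|tnth y i| rad) => [yr|/[dup] ry /hz hy]; lra.
apply: (@le_trans _ _ ((d%:R * (2 * D)) `^ p)).
  by apply: ge0_ler_powR; rewrite ?nnegrE ?sqrtr_ge0 ?mulr_ge0//; exact: ltW.
rewrite (_ : d%:R * (2 * D) = 2 * d%:R * D); last by ring.
rewrite [X in X <= _]powRM ?mulr_ge0// ler_wpM2l ?powR_ge0// mulrDr.
have := hp x; have := hp y; have := powR_ge0 s p; have := powR_ge0 (h x) p; have := powR_ge0 (h y) p.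
rewrite /D; case: (leP s (Num.max (h x) (h y))) => _; last by lra.
by case: (leP (h x) (h y)) => _; lra.
Qed.

(** * Counting the cells that meet a ball *)

Definition near_centre (l : nat) (B : R) : pred 'I_M :=
  fun k => `|k%:R - 2 ^+ (L - l)| < B.

(** For [l <= L], [2 ^+ (L - l)] is the index of the level-[l] cell that starts at the origin; what
    is counted are the integers within [B] of it. *)
Lemma card_near_centre l B : 0 <= B -> #|near_centre l B|%:R <= 2 * B + 1.
Proof.
move=> B0; pose n := Num.truncn B; pose c := (2 ^ (L - l))%N.
have cE : c%:R = 2 ^+ (L - l) :> R by rewrite natrX.
have sz : (#|near_centre l B| <= size (iota (c - n) (n + n).+1))%N.
  rewrite cardE -(size_map val); apply: uniq_leq_size.
    by rewrite map_inj_uniq ?enum_uniq//; exact: val_inj.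
  move=> _ /mapP[k kin ->]; rewrite mem_iota.
  have kB : `|k%:R - c%:R| < B by move: kin; rewrite mem_enum -topredE/= /near_centre -cE.
  have nk (m : nat) : m%:R < B -> (m <= n)%N by move=> mB; rewrite truncn_ge_nat// ltW.
  case: (leqP c k) => ck.
    have : (k - c <= n)%N by apply: nk; rewrite natrB// (le_lt_trans _ kB)// ler_norm.
    by rewrite /c/=; lia.
  have : (c - k <= n)%N.
    by apply: nk; rewrite natrB ?(ltnW ck)// (le_lt_trans _ kB)// distrC ler_norm.
  by rewrite /=; lia.
rewrite size_iota in sz; apply: (@le_trans _ _ (n + n).+1%:R); first by rewrite ler_nat.
by have := truncn_le B; rewrite B0 -/n -natr1 natrD => ?; lra.
Qed.

(** In units of [2 ^ l], the margin [3] more than covers the width of a cell and the overlap of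
    neighbouring hats. *)
Lemma block_far l (k : 'I_M) (rho t : R) : (l <= L)%N ->
  rho <= 2 ^+ L * eps -> ~~ near_centre l (rho / (2 ^+ l * eps) + 3) k ->
  block l k t != 0 -> rho <= `|t|.
Proof.
move=> lL rR; rewrite leNgt => kfar bk; apply: contra kfar => tr.
have [j /andP[/eqP jk hj]] : exists j, (cell l j == k) && (hat j t != 0).
  apply/existsP; apply: contraNT bk => /existsPn H; rewrite /block big1// => j jk.
  by have := H j; rewrite jk/= negbK => /eqP.
have /andP[a1 a2] := hat_support hj (lt_le_trans tr rR).
have {jk}kE : (k : nat) = (j %/ 2 ^ l)%N by rewrite -jk.
have H1 : (k * 2 ^ l <= j)%N by rewrite kE leq_trunc_div.
have H2 : (j.+1 <= k.+1 * 2 ^ l)%N by rewrite kE -ltn_divLR ?expn_gt0.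
have h1 : k%:R * 2 ^+ l <= j%:R :> R by rewrite -natrX -natrM ler_nat.
have h2 : j%:R + 1 <= (k%:R + 1) * 2 ^+ l :> R by rewrite !natr1 -natrX -natrM ler_nat.
have e0 : 0 < 2 ^+ l :> R by rewrite exprn_gt0.
have e1 : 1 <= 2 ^+ l :> R by rewrite exprn_ege1// ler1n.
have tr' : `|t / eps| < rho / eps.
  by rewrite normf_div (gtr0_norm eps0) ltr_pM2r ?invr_gt0.
move: tr'; rewrite ltr_norml => /andP[t1 t2].
have EL : 2 ^+ L = 2 ^+ (L - l) * 2 ^+ l :> R by rewrite -exprD subnK.
rewrite /near_centre -(ltr_pM2r e0) -[X in _ * X < _](gtr0_norm e0) -normrM mulrBl -EL.
have -> : (rho / (2 ^+ l * eps) + 3) * 2 ^+ l = rho / eps + 3 * 2 ^+ l.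
  by field; rewrite !gt_eqF.
rewrite ltr_norml; apply/andP; split; lra.
Qed.

Definition near_node (l : nat) (B : R) : pred leaf :=
  fun v => v \in ffun_on (near_centre l B).

Lemma card_near_node l B : 0 <= B -> #|near_node l B|%:R <= (2 * B + 1) ^+ d.
Proof.
move=> B0; rewrite (@eq_card _ _ (mem (ffun_on (near_centre l B)))) => [|v]; last by [].
rewrite card_ffun_on card_ord natrX lerXn2r ?nnegrE ?card_near_centre//.
by rewrite addr_ge0// mulr_ge0.
Qed.

Lemma node_far l (v : leaf) (rho : R) x : (l <= L)%N ->
  rho <= 2 ^+ L * eps -> ~~ near_node l (rho / (2 ^+ l * eps) + 3) v ->
  node l v x != 0 -> rho <= enorm x.
Proof.
move=> lL rR vfar nv.
have [i ki] : exists i, ~~ near_centre l (rho / (2 ^+ l * eps) + 3) (v i).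
  apply/existsP; apply: contraNT vfar => /existsPn H.
  by apply/familyP => i; have := H i; rewrite negbK.
apply: le_trans (coord_le_enorm x i); apply: (block_far lL rR ki).
by move: nv; apply: contraNneq => E; rewrite /node (bigD1 i)//= E mul0r.
Qed.

End dyadic_partition.

(** * Transport cost along the dyadic tree *)

Section image_law.
Context d1 d2 (T1 : measurableType d1) (T2 : measurableType d2) (R : realType).
Context (m : probability T1 R) (f : T1 -> T2).

(** As for [dens], the proof [mf] is an argument so that the probability instance is inferred from
    the term. *)
Definition image_law (mf : measurable_fun setT f) : set T2 -> \bar R := pushforward m f.

Context (mf : measurable_fun setT f).

Let image0 : image_law mf set0 = 0%E.
Proof. by rewrite /image_law /pushforward preimage_set0 measure0. Qed.

Let image_ge0 A : (0 <= image_law mf A)%E.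
Proof. exact: measure_ge0. Qed.

Let image_sigma_additive : semi_sigma_additive (image_law mf).
Proof.
move=> F mF tF mUF; rewrite /image_law /pushforward preimage_bigcup.
apply: measure_semi_sigma_additive.
- by move=> n; rewrite -[X in measurable X]setTI; exact: mf.
- apply/trivIsetP => /= i j _ _ ij; rewrite -preimage_setI.
  by move/trivIsetP : tF => /(_ _ _ _ _ ij) ->//; rewrite preimage_set0.
- by rewrite -preimage_bigcup -[X in measurable X]setTI; exact: mf.
Qed.

HB.instance Definition _ := isMeasure.Build _ _ _ (image_law mf)
  image0 image_ge0 image_sigma_additive.

Let image_setT : image_law mf setT = 1%E.
Proof. by rewrite /image_law /pushforward preimage_setT probability_setT. Qed.

HB.instance Definition _ := Measure_isProbability.Build _ _ _ (image_law mf) image_setT.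

End image_law.

Section transport_bound.
Context (R : realType) (d L : nat) (eps p q : R).
Hypothesis eps0 : 0 < eps.
Hypothesis p0 : 0 < p.
Hypothesis pq : p < q.
Local Notation T := (d.-tuple R).
Local Notation leaf := {ffun 'I_d -> 'I_(2 ^ L.+1)}.
Context (nu mu : probability T R).

(** Mass matched at level [l.+1] travels at scale [2 ^+ l.+1 * eps] but is bounded by the
    discrepancy one level below, hence the shift of index in the sum. Level 0 carries mass at most 1
    and gives [eps^p]. The last term is the cost outside the window. *)
Lemma tree_transport_bound : exists pi : probability (T * T)%type R,
  is_coupling nu mu pi /\
  (\int[pi]_z ((edist z.1 z.2) `^ p)%:E <=
    ((2 * d%:R) `^ p * (eps `^ p + \sum_(l < L.+1) (2 ^+ l.+1 * eps) `^ p *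
      \sum_(v : leaf) `|expect nu (node eps l v) - expect mu (node eps l v)|))%:E +
    ((2 * d%:R) `^ p * (2 ^+ L * eps) `^ (p - q))%:E *
      (\int[nu]_x (enorm x `^ q)%:E + \int[mu]_x (enorm x `^ q)%:E))%E.
Proof.
pose K : R := (2 * d%:R) `^ p.
have K0 : 0 <= K by exact: powR_ge0.
pose a (F : leaf) := expect nu (tile eps F).
pose b (F : leaf) := expect mu (tile eps F).
have bt (F : leaf) : bounded01 (tile eps F) by exact: bounded01_tile.
have a0 F : 0 <= a F by apply: expect_ge0 => x; exact: tile_ge0.
have b0 F : 0 <= b F by apply: expect_ge0 => x; exact: tile_ge0.
have sum1 (m : probability T R) : \sum_(F : leaf) expect m (tile eps F) = 1.
  rewrite -expect_sum// -(expect1 m); congr (expect m _).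
  by apply/funext => x; exact: sum_tile.
have disc_node l : disc a b (@anc d L l) =
    \sum_(v : leaf) `|expect nu (node eps l v) - expect mu (node eps l v)|.
  apply: eq_bigr => v _; rewrite /a /b -!expect_sum//.
  have -> : node eps l v = (fun x => \sum_(F | anc l F == v) tile eps F x).
    by apply/funext => x; exact: node_tile.
  by [].
have [c [[c0 canc cfst csnd] [c_init c_next]]] :=
  tree_matching (@ancS d L) (@anc_top d L) a0 b0 (etrans (sum1 nu) (esym (sum1 mu))).
pose ct F G := \sum_(l < L.+2) c l F G.
have ct0 F G : 0 <= ct F G by apply: sumr_ge0 => l _; exact: c0.
have meet F G : exists l, anc l F == anc l G :> leaf.
  by exists L.+1; apply/eqP; exact: anc_top.
(* The mass of a pair is a sum over levels, while [coupling_from_discrete] takes one cost per pair.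
   The cost at the least common level is at most that of any level where [c l F G] is nonzero. *)
pose E F G := K * (2 ^+ (ex_minn (meet F G)) * eps) `^ p.
have E0 F G : 0 <= E F G by rewrite mulr_ge0// powR_ge0.
have scale0 n : 0 <= 2 ^+ n * eps by rewrite mulr_ge0 ?exprn_ge0// ltW.
have E_le l F G : c l F G * E F G <= c l F G * (K * (2 ^+ l * eps) `^ p).
  have [->|cl] := eqVneq (c l F G) 0; first by rewrite !mul0r.
  rewrite ler_wpM2l// ler_wpM2l// ge0_ler_powR ?nnegrE ?(ltW p0)// ler_wpM2r ?(ltW eps0)//.
  rewrite ler_eXn2l ?ltr1n//; case: ex_minnP => m _ /(_ l); apply.
  by apply/eqP; exact: canc.
have mpow : measurable_fun setT (fun z : T * T => edist z.1 z.2 `^ p).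
  exact: (measurableT_comp (measurable_powR p) (@measurable_edist R d)).
have mw : measurable_fun setT (fun x : T => enorm x `^ q).
  exact: (measurableT_comp (measurable_powR q) (@measurable_enorm R d)).
have [|||||||||pi [cpi pile]] := @coupling_from_discrete _ _ nu mu _ (@tile R d L eps) ct bt (@sum_tile R d L eps) ct0 _ _
   (fun z => edist z.1 z.2 `^ p) E (fun x => enorm x `^ q) (K * (2 ^+ L * eps) `^ (p - q)).
- by move=> F; rewrite /ct exchange_big/= cfst.
- by move=> G; rewrite /ct exchange_big/= csnd.
- exact: mpow.
- by move=> z; exact: powR_ge0.
- exact: mw.
- by move=> x; exact: powR_ge0.
- exact: E0.
- by rewrite mulr_ge0// powR_ge0.
- move=> F G x y _ Fx Gy; rewrite /= /E; case: ex_minnP => l /eqP lFG _.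
  by apply: (le_trans (tile_cost eps0 p0 pq Fx Gy lFG)); rewrite -/K; lra.
exists pi; split=> //; apply: (le_trans pile); apply: leeD => //.
rewrite lee_fin; under [X in _ <= _ * (_ + X)]eq_bigr do rewrite -disc_node.
apply: (@le_trans _ _ (\sum_(l < L.+2) \sum_F \sum_G c l F G * (K * (2 ^+ l * eps) `^ p))).
  rewrite [X in _ <= X]exchange_big/=; apply: ler_sum => F _.
  rewrite [X in _ <= X]exchange_big/=; apply: ler_sum => G _.
  by rewrite /ct mulr_suml; apply: ler_sum => l _; exact: E_le.
have pull l : \sum_F \sum_G c l F G * (K * (2 ^+ l * eps) `^ p) =
    K * ((2 ^+ l * eps) `^ p * \sum_F \sum_G c l F G).
  rewrite !mulr_sumr; apply: eq_bigr => F _; rewrite !mulr_sumr; apply: eq_bigr => G _.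
  ring.
rewrite big_ord_recl/= mulrDr; apply: lerD.
  rewrite pull expr0 mul1r ler_wpM2l// ler_piMr ?powR_ge0//.
  by rewrite -(sum1 nu).
rewrite mulr_sumr; apply: ler_sum => l _.
by rewrite pull /bump/= add1n ler_wpM2l// ler_wpM2l ?powR_ge0// c_next.
Qed.

End transport_bound.

(** * Expected transport cost *)

Section mean_transport.
Context (R : realType) (d : nat) (dO : measure_display) (Omega : measurableType dO).
Context (Pr : probability Omega R).
Local Notation T := (d.-tuple R).
Context (X : R -> Omega -> T) (P : R -> R.-pker T ~> T) (mu : probability T R).
Context (C lamE p q : R).
Hypothesis invP : is_invariant P mu.
Hypothesis markX : is_markov_process Pr X P mu.
Hypothesis C0 : 0 <= C.
Hypothesis lam0 : 0 < lamE.
Hypothesis contrP : forall (nu : probability T R) (t : R), 0 <= t ->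
     (W1 (mker nu (P t)) (mker mu (P t)) <=
      (C * expR (- lamE * t))%:E * W1 nu mu)%E.
Hypothesis p0 : 0 < p.
Hypothesis pq : p < q.
Hypothesis q1 : 1 < q.
Hypothesis mom : (\int[mu]_x (enorm x `^ q)%:E < +oo)%E.

Let mq : R := fine (\int[mu]_x (enorm x `^ q)%:E).
Let q0 : 0 < q. Proof. exact: lt_trans pq. Qed.

Let mpow : measurable_fun setT (fun x : T => enorm x `^ q).
Proof. exact: (measurableT_comp (measurable_powR q) (@measurable_enorm R d)). Qed.

Let mqE : (\int[mu]_x (enorm x `^ q)%:E = mq%:E)%E.
Proof.
rewrite fineK// ge0_fin_numE//; apply: integral_ge0 => x _.
by rewrite lee_fin powR_ge0.
Qed.

Let mq0 : 0 <= mq.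
Proof. by rewrite fine_ge0//; apply: integral_ge0 => x _; rewrite lee_fin powR_ge0. Qed.

(** Since [|x| <= 1 + |x|^q], used once pointwise and once under the integral, this dominates
    [|x| + mu|.|]. It also dominates 1, which handles the cells of weight 0, and [|x|^q], which
    handles the far cells. *)
Definition moment_weight (x : T) : R := 2 + mq + enorm x `^ q.
Local Notation W := moment_weight.

Let mW : measurable_fun setT W.
Proof. by apply: measurable_funD. Qed.

Let enorm_le (x : T) : enorm x <= 1 + enorm x `^ q.
Proof.
have n0 : 0 <= enorm x by rewrite sqrtr_ge0.
case: (leP (enorm x) 1) => [x1|x1]; first by rewrite (le_trans x1)// lerDl powR_ge0.
rewrite (@le_trans _ _ (enorm x `^ q)) ?lerDr//.
by rewrite -[X in X <= _]powRr1// ler_powR// ltW.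
Qed.

Let int1D : (\int[mu]_x (1 + enorm x `^ q)%:E = (1 + mq)%:E)%E.
Proof.
under eq_integral do rewrite EFinD.
rewrite ge0_integralD//; last 2 first.
- by move=> x _; rewrite lee_fin powR_ge0.
- exact/measurable_EFinP.
by rewrite integral_cst//= probability_setT mule1 mqE.
Qed.

Let W_enorm x : (\int[mu]_y (enorm y)%:E + (enorm x)%:E <= (W x)%:E)%E.
Proof.
apply: (@le_trans _ _ ((1 + mq)%:E + (1 + enorm x `^ q)%:E)%E).
  apply: leeD; last by rewrite lee_fin.
  by rewrite -int1D; apply: ge0_le_integralT => y; rewrite lee_fin ?sqrtr_ge0.
by rewrite -EFinD lee_fin /W; lra.
Qed.

Let W1' x : 1 <= W x.
Proof. by rewrite /W; have := powR_ge0 (enorm x) q; have := mq0; lra. Qed.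

Let W0 x : 0 <= W x. Proof. exact: le_trans (W1' x). Qed.

Let int_W : (\int[mu]_x (W x)%:E = (2 + 2 * mq)%:E)%E.
Proof.
rewrite (_ : (\int[mu]_x _)%E = (\int[mu]_x ((1 + mq)%:E + (1 + enorm x `^ q)%:E))%E); last first.
  by apply: eq_integral => x _; rewrite -EFinD; congr EFin; rewrite /W; ring.
rewrite ge0_integralD//; last 3 first.
- by move=> x _; rewrite lee_fin addr_ge0.
- by move=> x _; rewrite lee_fin addr_ge0// powR_ge0.
- by apply/measurable_EFinP; exact: measurable_funD.
rewrite int1D integral_cst//= probability_setT mule1 -EFinD; congr EFin; ring.
Qed.

Let W_int : (\int[mu]_x (W x)%:E < +oo)%E.
Proof. by rewrite int_W ltry. Qed.

Context (L : nat) (eps Tm : R).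
Hypothesis eps0 : 0 < eps.
Hypothesis Tm0 : 0 < Tm.
Local Notation leaf := {ffun 'I_d -> 'I_(2 ^ L.+1)}.

(** The factor [2 K d.+1 C / (lamE Tm)] of the variance bound with [K = 2 d.+1 / eps]; writing
    [d.+1] for [d] keeps [K] positive when [d = 0]. *)
Definition fluctuation : R := 4 * d.+1%:R ^+ 2 * C / lamE / (eps * Tm).
Local Notation V := fluctuation.

Let V0 : 0 <= V.
Proof. by rewrite divr_ge0 ?mulr_ge0 ?invr_ge0// ltW. Qed.

Let dev l (v : leaf) w := `|time_average X Tm0 (node eps l v) w - expect mu (node eps l v)|.

Let weight l (v : leaf) := expect mu (fun x => (node eps l v x * W x)%R).

Let bn l (v : leaf) : bounded01 (node eps l v). Proof. exact: bounded01_node. Qed.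
Let n0 l (v : leaf) x : 0 <= node eps l v x. Proof. by case: (bn l v) => _ /(_ x)/andP[]. Qed.

Let weight0 l v : 0 <= weight l v.
Proof. by apply: expect_ge0 => x; rewrite mulr_ge0. Qed.

Let weightE l v : (\int[mu]_x (node eps l v x * W x)%:E = (weight l v)%:E)%E.
Proof. exact: (weighted_fin W_enorm W_int (bn l v)). Qed.

Let sum_weight l : \sum_v weight l v = 2 + 2 * mq.
Proof.
apply: EFin_inj; rewrite -int_W -sumEFin.
under eq_bigr do rewrite -weightE.
rewrite -ge0_integral_sum//.
- apply: eq_integral => x _; rewrite sumEFin -mulr_suml.
  suff -> : \sum_(v : leaf) node eps l v x = 1 by rewrite mul1r.
  under eq_bigr do rewrite node_tile.
  by rewrite (sum_fibres (@anc d L l)) sum_tile.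
- by move=> v; apply/measurable_EFinP; apply: measurable_funM => //; case: (bn l v).
- by move=> v x _; rewrite lee_fin mulr_ge0.
Qed.

(** The variance bound is proportional to [weight l v]. Taking [kap = tau * weight l v] leaves one
    term proportional to the weight, which sums over all cells to a constant times [tau], and a term
    [V / tau] that is the same for all cells and is paid once for each near one. *)
Let dev_near l v tau : 0 < tau ->
  (\int[Pr]_w (dev l v w)%:E <= (2 * tau * weight l v + V / tau)%:E)%E.
Proof.
move=> tau0.
(* The choice of [kap] requires a positive weight. A null weight forces a null mean, because the
   moment weight is at least 1. *)
have [w00|wn0] := eqVneq (weight l v) 0.
  apply: (le_trans (mean_abs_deviation_trivial invP markX Tm0 (bn l v))).
  rewrite lee_fin w00 mulr0 add0r; apply: (@le_trans _ _ 0); last by rewrite divr_ge0// ltW.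
  rewrite pmulr_rle0// -w00 -lee_fin -expectE// -weightE.
  apply: ge0_le_integralT => x; rewrite lee_fin//.
  by rewrite -[X in X <= _]mulr1 ler_wpM2l.
have w_gt0 : 0 < weight l v by rewrite lt_neqAle eq_sym wn0 weight0.
pose K := 2 * d.+1%:R / eps.
have K0 : 0 < K by rewrite divr_gt0.
have KL : edist_lipschitz K (node eps l v).
  move=> x y; apply: (le_trans (node_lip eps0 l v x y)).
  rewrite ler_wpM2r ?sqrtr_ge0// ler_wpM2r ?invr_ge0 ?(ltW eps0)//.
  by rewrite ler_pM2l// ler_nat.
have := mean_abs_deviation_le invP markX C0 lam0 contrP mW W_enorm W_int Tm0 (bn l v) K0 KL (mulr_gt0 tau0 w_gt0).
move=> /le_trans; apply; rewrite lee_fin -/(weight l v).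
have -> : forall A : R, A * weight l v / (tau * weight l v) = A / tau.
  by move=> A; field; rewrite wn0 gt_eqF.
apply: lerD; first by rewrite -mulrA ler_peMl ?ler1n// mulr_ge0// ltW.
rewrite ler_wpM2r ?invr_ge0 ?(ltW tau0)//.
have -> : V = 2 * K * d.+1%:R * C / (lamE * Tm).
  by rewrite /V /K; field; rewrite !gt_eqF.
have lT0 : 0 <= (lamE * Tm)^-1 by rewrite invr_ge0 mulr_ge0// ltW.
rewrite ler_wpM2r// ler_wpM2r// ler_wpM2l ?ler_nat//.
by rewrite mulr_ge0// ltW.
Qed.

(** On the support the moment weight is at least [|x|^q >= rho^q >= 1 / tau], so twice the mean is
    already below the first term of [dev_near], and far cells need not be counted. *)
Let dev_far l v tau rho : 0 < rho -> rho `^ (- q) <= tau ->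
  (forall x, node eps l v x != 0 -> rho <= enorm x) ->
  (\int[Pr]_w (dev l v w)%:E <= (2 * tau * weight l v)%:E)%E.
Proof.
move=> rho0 rtau far.
apply: (le_trans (mean_abs_deviation_trivial invP markX Tm0 (bn l v))).
rewrite -mulrA EFinM [X in (_ <= X)%E]EFinM; apply: lee_wpmul2l; first by rewrite lee_fin.
have tau0 : 0 <= tau by rewrite (le_trans _ rtau)// powR_ge0.
rewrite -expectE// EFinM -weightE -ge0_integralZl_EFin//; last 2 first.
- by move=> x _; rewrite lee_fin mulr_ge0.
- by apply/measurable_EFinP; apply: measurable_funM => //; case: (bn l v).
apply: ge0_le_integralT => x; rewrite lee_fin// mulrCA -[X in X <= _]mulr1.
have [->|nx] := eqVneq (node eps l v x) 0; first by rewrite !mul0r.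
rewrite ler_wpM2l//.
have rx : rho `^ q <= W x.
  apply: (@le_trans _ _ (enorm x `^ q)).
    by apply: ge0_ler_powR; rewrite ?nnegrE ?sqrtr_ge0 ?far//; exact: ltW.
  by rewrite /W lerDr addr_ge0.
apply: (@le_trans _ _ (rho `^ (- q) * rho `^ q)).
  by rewrite -powRD ?(gt_eqF rho0) ?implybT// addNr powRr0.
by rewrite ler_pM ?powR_ge0.
Qed.

Lemma level_fluctuation_le l tau rho : (l <= L)%N -> 0 < tau -> 0 < rho ->
  rho <= 2 ^+ L * eps -> rho `^ (- q) <= tau ->
  (\sum_v \int[Pr]_w (dev l v w)%:E <=
   (2 * tau * (2 + 2 * mq) + (2 * (rho / (2 ^+ l * eps) + 3) + 1) ^+ d * (V / tau))%:E)%E.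
Proof.
move=> lL tau0 rho0 rR rtau.
pose B := rho / (2 ^+ l * eps) + 3.
have B0 : 0 <= B by rewrite addr_ge0// divr_ge0 ?mulr_ge0 ?exprn_ge0// ltW.
apply: (@le_trans _ _ (\sum_v (2 * tau * weight l v + if near_node l B v then V / tau else 0)%:E)%E).
  apply: lee_sum => v _; case: ifPn => [_|vfar]; first exact: dev_near.
  rewrite addr0; apply: (dev_far rho0 rtau) => x.
  exact: (node_far eps0 lL rR vfar).
rewrite sumEFin lee_fin big_split/= -mulr_sumr sum_weight lerD2l.
rewrite -big_mkcond/= sumr_const -[X in X <= _]mulr_natl.
by apply: ler_wpM2r; [rewrite divr_ge0// ltW|exact: card_near_node].
Qed.

Lemma Tp_empirical_le w :
  (Tp p (empirical X Tm w) mu <=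
   ((2 * d%:R) `^ p * (eps `^ p + \sum_(l < L.+1) (2 ^+ l.+1 * eps) `^ p *
      \sum_v dev l v w))%:E +
    ((2 * d%:R) `^ p * (2 ^+ L * eps) `^ (p - q))%:E *
      (\int[unif Tm0]_t (enorm (X t w) `^ q)%:E + mq%:E))%E.
Proof.
(* The empirical measure is the law of [X U w] for [U] uniform on [[0, Tm]]. *)
pose nu : probability T R := image_law (unif Tm0) (measurable_path markX w).
have nuE (g : T -> \bar R) : measurable_fun setT g -> (forall x, 0 <= g x)%E ->
    (\int[nu]_x g x = \int[unif Tm0]_t g (X t w))%E.
  by move=> mg g0; exact: (ge0_integral_pushforwardT (unif Tm0) (measurable_path markX w) mg g0).
have [pi [cpi pile]] := @tree_transport_bound R d L eps p q eps0 p0 pq nu mu.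
apply: (@le_trans _ _ (\int[pi]_z ((edist z.1 z.2) `^ p)%:E)%E).
  apply: ereal_inf_lbound; exists pi; split=> // A mA; have [c1 c2] := cpi A mA.
  split=> //; rewrite c1 /empirical.
  transitivity (nu (A `&` setT)); first by rewrite setIT.
  rewrite -(integral_indic nu measurableT mA).
  have mi : measurable_fun setT (fun x : T => (\1_A x)%:E : \bar R).
    by apply/measurable_EFinP; exact: measurable_indic.
  have i0 (x : T) : (0 <= (\1_A x)%:E :> \bar R)%E by rewrite lee_fin.
  rewrite nuE// integral_unif//.
  exact: (measurableT_comp mi (measurable_path markX w)).
have mE : measurable_fun setT (fun x : T => (enorm x `^ q)%:E) by exact/measurable_EFinP.
have E0 (x : T) : (0 <= (enorm x `^ q)%:E)%E by rewrite lee_fin powR_ge0.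
apply: (le_trans pile); rewrite mqE nuE//; apply: leeD => //.
rewrite lee_fin /dev ler_wpM2l ?powR_ge0// lerD2l.
apply: ler_sum => l _; rewrite ler_wpM2l ?powR_ge0//.
apply: ler_sum => v _; rewrite /time_average.
suff -> : expect nu (node eps l v) = expect (unif Tm0) (fun t => node eps l v (X t w)) by [].
rewrite /expect nuE//; first by apply/measurable_EFinP; case: (bn l v).
by move=> x; rewrite lee_fin.
Qed.

Lemma mean_transport_le (tau rho : nat -> R) :
  (forall l, (l <= L)%N -> [/\ 0 < tau l, 0 < rho l, rho l <= 2 ^+ L * eps &
     rho l `^ (- q) <= tau l]) ->
  (\int[Pr]_w Tp p (empirical X Tm w) mu <=
   ((2 * d%:R) `^ p * (eps `^ p + \sum_(l < L.+1) (2 ^+ l.+1 * eps) `^ p *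
      (2 * tau l * (2 + 2 * mq) +
       (2 * (rho l / (2 ^+ l * eps) + 3) + 1) ^+ d * (V / tau l))) +
    (2 * d%:R) `^ p * (2 ^+ L * eps) `^ (p - q) * (2 * mq))%:E)%E.
Proof.
move=> H; set K := (2 * d%:R) `^ p; set r := (2 ^+ L * eps) `^ (p - q).
have K0 : 0 <= K by exact: powR_ge0.
have r0 : 0 <= r by exact: powR_ge0.
pose s (l : nat) := (2 ^+ l.+1 * eps) `^ p.
have s0 l : 0 <= s l by exact: powR_ge0.
have mdev l v : measurable_fun setT (dev l v).
  apply: measurableT_comp => //; apply: measurable_funB => //.
  exact: (measurable_time_average markX Tm0 (bn l v)).
have mX : measurable_fun setT (fun z : R * Omega => X z.1 z.2) by case: markX.
have mE : measurable_fun setT (fun x : T => (enorm x `^ q)%:E) by exact/measurable_EFinP.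
have E0 (x : T) : (0 <= (enorm x `^ q)%:E)%E by rewrite lee_fin powR_ge0.
pose Q w := (\int[unif Tm0]_t (enorm (X t w) `^ q)%:E)%E.
have Q0 w : (0 <= Q w)%E by apply: integral_ge0.
have mQ : measurable_fun setT Q.
  apply: (@measurable_fun_fubini_tonelli_G _ _ _ _ _ (unif Tm0) (fun z => (enorm (X z.1 z.2) `^ q)%:E)) => //.
  exact: (measurableT_comp mE mX).
have intQ : (\int[Pr]_w Q w = mq%:E)%E by rewrite (mean_time_average invP markX Tm0 mE E0) mqE.
pose D (w : Omega) := \sum_(l < L.+1) s l * \sum_v dev l v w.
have D0 w : 0 <= D w.
  by apply: sumr_ge0 => l _; rewrite mulr_ge0// sumr_ge0// => v _; exact: normr_ge0.
have mD : measurable_fun setT D.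
  by apply: measurable_sum => l; apply: measurable_funM => //; exact: measurable_sum.
have intD : (\int[Pr]_w (D w)%:E <= (\sum_(l < L.+1) s l * (2 * tau l * (2 + 2 * mq) +
       (2 * (rho l / (2 ^+ l * eps) + 3) + 1) ^+ d * (V / tau l)))%:E)%E.
  under eq_integral do rewrite -sumEFin.
  rewrite ge0_integral_sum//; last 2 first.
  - by move=> l; apply/measurable_EFinP; apply: measurable_funM => //; exact: measurable_sum.
  - by move=> l w _; rewrite lee_fin mulr_ge0// sumr_ge0// => v _; exact: normr_ge0.
  rewrite -sumEFin; apply: lee_sum => l _.
  under eq_integral do rewrite EFinM.
  rewrite ge0_integralZl_EFin//; last 2 first.
  - by move=> w _; rewrite lee_fin sumr_ge0// => v _; exact: normr_ge0.
  - by apply/measurable_EFinP; exact: measurable_sum.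
  rewrite EFinM; apply: lee_wpmul2l; first by rewrite lee_fin.
  under eq_integral do rewrite -sumEFin.
  rewrite ge0_integral_sum//; last 2 first.
  - by move=> v; exact/measurable_EFinP.
  - by move=> v w _; rewrite lee_fin normr_ge0.
  have lL : (l <= L)%N by rewrite -ltnS.
  by have [t0 rho0 rR rt] := H l lL; exact: level_fluctuation_le.
apply: (@le_trans _ _ (\int[Pr]_w (((K * eps `^ p)%:E + K%:E * (D w)%:E) + (K * r)%:E * (Q w + mq%:E)))%E).
  (* Measurability of the transport cost as a function of [w] is not established; the comparison of
     integrals goes through without it, the upper bound being measurable. *)
  apply: ge0_le_integralT => w; last first.
    apply: (le_trans (Tp_empirical_le w)); apply: leeD => //.
    by rewrite -EFinM -EFinD lee_fin mulrDr.
  apply: le_ereal_inf_tmp => _ [pi [_ ->]]; apply: integral_ge0 => z _.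
  by rewrite lee_fin powR_ge0.
have KD0 w : (0 <= K%:E * (D w)%:E)%E by rewrite -EFinM lee_fin mulr_ge0.
have Ke0 : (0 <= (K * eps `^ p)%:E)%E by rewrite lee_fin mulr_ge0// powR_ge0.
have mKD : measurable_fun setT (fun w => (K%:E * (D w)%:E)%E).
  by apply: emeasurable_funM => //; exact/measurable_EFinP.
have mQq : measurable_fun setT (fun w => (Q w + mq%:E)%E) by exact: emeasurable_funD.
have Qq0 w : (0 <= Q w + mq%:E)%E by rewrite adde_ge0// lee_fin.
have Kr0 : (0 <= (K * r)%:E)%E by rewrite lee_fin mulr_ge0.
rewrite ge0_integralD//; last 4 first.
- by move=> w _; rewrite adde_ge0.
- by apply: emeasurable_funD.
- by move=> w _; rewrite mule_ge0.
- by apply: emeasurable_funM.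
rewrite EFinD; apply: leeD.
  rewrite ge0_integralD// integral_cst//= probability_setT mule1 mulrDr EFinD leeD2l//.
  rewrite ge0_integralZl_EFin//; last 2 first.
  - by move=> w _; rewrite lee_fin.
  - exact/measurable_EFinP.
  by rewrite EFinM; apply: lee_wpmul2l; rewrite ?lee_fin.
rewrite ge0_integralZl_EFin ?mulr_ge0//.
rewrite ge0_integralD// intQ integral_cst//= probability_setT mule1 -EFinD -EFinM.
by rewrite lee_fin le_eqVlt; apply/orP; left; apply/eqP; ring.
Qed.

End mean_transport.

(** * Choice of the scales *)

Lemma sum_geometric_rev_le (R : realFieldType) (r : R) (L : nat) : 0 < r -> r < 1 ->
  \sum_(l < L.+1) r ^+ (L - l) <= (1 - r)^-1.
Proof.
move=> r0 r1; rewrite (reindex_inj rev_ord_inj)/=.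
rewrite (eq_bigr (fun i : 'I_L.+1 => r ^+ i)); last first.
  by move=> i _; rewrite subSS subKn// -ltnS.
have := subrX1 r L.+1; set S := \sum_(i < _) _ => E.
have r10 : 0 < 1 - r by rewrite subr_gt0.
rewrite -(ler_pM2l r10) divff ?gt_eqF//.
have -> : (1 - r) * S = 1 - r ^+ L.+1 by rewrite -[LHS]opprK -mulNr opprB -E opprB.
by rewrite gerBl exprn_ge0// ltW.
Qed.

Section exponents.
Context (R : realType) (p q zeta sigma : R) (d L : nat).
Hypothesis p0 : 0 < p.
Hypothesis pq : p < q.
Hypothesis zq : q <= zeta * (q - p).
Hypothesis zd : d%:R <= zeta * p.
Hypothesis sigE : sigma * (2 + d%:R / q) = p.

Let q0 : 0 < q. Proof. exact: lt_trans pq. Qed.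
Let b0 : 0 < q - p. Proof. by rewrite subr_gt0. Qed.

(** The solution [eps] of [(2^L eps)^(p - q) = eps^p]: the part outside the window then costs as
    much as the finest scale. *)
Definition mesh : R := 2 `^ (- (L%:R * (q - p) / q)).
(** Chosen so that [(2^l mesh)^p] times it equals [mesh^p 2^(- sigma (L - l))], a geometric series
    from the coarsest level down. *)
Definition level_weight (l : nat) : R := 2 `^ (- (p * l%:R + sigma * (L - l)%:R)).
(** The power [-1/q] of the level weight, which is the smallest radius that [dev_far] admits. *)
Definition level_radius (l : nat) : R := 2 `^ ((p * l%:R + sigma * (L - l)%:R) / q).

Let pow2_neq0 : (2 : R) != 0. Proof. by []. Qed.

Lemma pow2D (x y : R) : 2 `^ x * 2 `^ y = 2 `^ (x + y) :> R.
Proof. by rewrite powRD// pow2_neq0 implybT. Qed.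

Lemma pow2X (n : nat) : (2 : R) ^+ n = 2 `^ n%:R.
Proof. by rewrite powR_mulrn. Qed.

Lemma le_pow2 (x y : R) : x <= y -> 2 `^ x <= 2 `^ y :> R.
Proof. by move=> xy; rewrite ler_powR// ler1n. Qed.

Lemma one_le_pow2 (x : R) : 0 <= x -> 1 <= 2 `^ x :> R.
Proof. by move=> /le_pow2; rewrite powRr0. Qed.

Lemma sigma_gt0 : 0 < sigma.
Proof.
have c0 : 0 < 2 + d%:R / q by rewrite ltr_wpDr// divr_ge0// ltW.
by rewrite -(pmulr_lgt0 _ c0) sigE.
Qed.

Lemma sigma_le : sigma <= p.
Proof.
rewrite -sigE -[X in X <= _]mulr1 ler_wpM2l ?(ltW sigma_gt0)//.
have : 0 <= d%:R / q by rewrite divr_ge0// ltW.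
by move=> ?; lra.
Qed.

Lemma mesh_gt0 : 0 < mesh. Proof. exact: powR_gt0. Qed.

Lemma scale_pow2 l : 2 ^+ l * mesh = 2 `^ (l%:R - L%:R * (q - p) / q).
Proof. by rewrite pow2X pow2D. Qed.

Lemma level_radius_le l : (l <= L)%N -> level_radius l <= 2 ^+ L * mesh.
Proof.
move=> lL; rewrite scale_pow2 le_pow2//.
have -> : L%:R - L%:R * (q - p) / q = (p * L%:R) / q by field; rewrite gt_eqF.
rewrite ler_pM2r ?invr_gt0// natrB//.
have : sigma * (L%:R - l%:R) <= p * (L%:R - l%:R).
  by rewrite ler_wpM2r ?sigma_le// subr_ge0 ler_nat.
by lra.
Qed.

Lemma level_radius_weight l : level_radius l `^ (- q) = level_weight l.
Proof. by rewrite -powRrM mulrN divfK// gt_eqF. Qed.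

Lemma top_scale_pow : (2 ^+ L * mesh) `^ (p - q) = mesh `^ p.
Proof.
rewrite scale_pow2 -!powRrM; congr (_ `^ _).
by field; rewrite gt_eqF.
Qed.

(* The choice of [sigma] makes this an equality at [l = L], [zeta = q / (q - p)]. *)
Lemma exponent_le l : (l <= L)%N ->
  p * (l%:R - L%:R * (q - p) / q) + (L - l)%:R * (q - p + sigma) / q * d%:R
    - 2 * zeta * p * (L%:R * (q - p) / q) + (p * l%:R + sigma * (L - l)%:R)
  <= - (p * (L%:R * (q - p) / q)) - sigma * (L - l)%:R.
Proof.
move=> lL; rewrite natrB//.
set l' := l%:R; set L' := L%:R; set j := L' - l'.
have j0 : 0 <= j by rewrite subr_ge0 ler_nat.
have l0 : 0 <= l' by exact: ler0n.
(* The exponent gained from the fluctuation is [2 Z L' = 2 Z l' + 2 Z j]. The part [2 Z l'] covers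
   [2 p l']. Of [2 Z j], one half covers the growth [d (q - p) / q] of the number of cells, and the
   other provides [p j], which is exactly [2 sigma j + sigma (d / q) j]: this is the equation that
   defines [sigma]. *)
pose Z := zeta * p * (q - p) / q.
have Zp : p <= Z.
  by rewrite /Z ler_pdivlMr//; have := ler_wpM2l (ltW p0) zq; lra.
have Zd : d%:R * (q - p) / q <= Z.
  by rewrite /Z ler_pM2r ?invr_gt0// ler_pM2r.
have H1 : p * l' <= Z * l' by rewrite ler_wpM2r.
have H2 : (d%:R * (q - p) / q) * j <= Z * j by rewrite ler_wpM2r.
have H3 : p * j <= Z * j by rewrite ler_wpM2r.
have H4 : sigma * (2 + d%:R / q) * j = p * j by rewrite sigE.
have E1 : j * (q - p + sigma) / q * d%:R = (d%:R * (q - p) / q) * j + sigma * (d%:R / q) * j.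
  by field; rewrite gt_eqF.
have E2 : 2 * zeta * p * (L' * (q - p) / q) = 2 * (Z * j) + 2 * (Z * l').
  by rewrite /Z /j; field; rewrite gt_eqF.
rewrite E1 E2.
have H4' : sigma * (d%:R / q) * j = p * j - 2 * (sigma * j).
  by rewrite -H4; ring.
rewrite H4' mulrBr; lra.
Qed.

Lemma level_term_le (A K0 V : R) l : (l <= L)%N -> 0 <= A -> 0 <= K0 ->
  V <= K0 * mesh `^ (2 * zeta * p) ->
  (2 ^+ l.+1 * mesh) `^ p *
    (2 * level_weight l * A +
     (2 * (level_radius l / (2 ^+ l * mesh) + 3) + 1) ^+ d * (V / level_weight l))
  <= 2 `^ p * mesh `^ p * (2 * A + 9 ^+ d * K0) * (2 `^ (- sigma)) ^+ (L - l).
Proof.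
move=> lL A0 K00 VK.
pose j : R := (L - l)%:R.
have j0 : 0 <= j by exact: ler0n.
pose e := - (L%:R * (q - p) / q).
have -> : (2 ^+ l.+1 * mesh) `^ p = 2 `^ p * 2 `^ (p * (l%:R + e)).
  rewrite exprS -mulrA powRM ?mulr_ge0 ?exprn_ge0 ?(ltW mesh_gt0)//.
  by rewrite scale_pow2 -powRrM; congr (_ * _ `^ _); rewrite /e; ring.
have -> : (2 `^ (- sigma)) ^+ (L - l) = 2 `^ (- sigma * j).
  by rewrite -powR_mulrn ?powR_ge0// -powRrM.
have -> : mesh `^ p = 2 `^ (p * e) by rewrite -powRrM mulrC.
set P1 := 2 `^ (p * (l%:R + e)); set P2 := 2 `^ (p * e); set P3 := 2 `^ (- sigma * j).
have -> : 2 `^ p * P2 * (2 * A + 9 ^+ d * K0) * P3 =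
  2 `^ p * (2 * A * (P2 * P3) + 9 ^+ d * K0 * (P2 * P3)) by ring.
rewrite -mulrA ler_wpM2l ?powR_ge0// mulrDr; apply: lerD.
  have -> : P1 * (2 * level_weight l * A) = 2 * A * (P1 * level_weight l) by ring.
  rewrite /level_weight /P1 /P2 /P3 !pow2D ler_wpM2l ?mulr_ge0// le_pow2// -/j.
  by rewrite le_eqVlt; apply/orP; left; apply/eqP; ring.
rewrite /P1 /P2 /P3 {P1 P2 P3}.
have ratio : level_radius l / (2 ^+ l * mesh) = 2 `^ (j * (q - p + sigma) / q).
  rewrite scale_pow2 /level_radius -powRN pow2D; congr (_ `^ _).
  by rewrite /j natrB//; field; rewrite gt_eqF.
have ratio1 : 1 <= level_radius l / (2 ^+ l * mesh).
  rewrite ratio one_le_pow2// divr_ge0 ?(ltW q0)// mulr_ge0// addr_ge0 ?(ltW b0)//.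
  exact: ltW sigma_gt0.
(* The constant [9] comes from [2 (x + 3) + 1 <= 9 x] for [x >= 1]. *)
have B9 : (2 * (level_radius l / (2 ^+ l * mesh) + 3) + 1) ^+ d <=
    9 ^+ d * 2 `^ (j * (q - p + sigma) / q * d%:R).
  rewrite powRrM powR_mulrn ?powR_ge0// -ratio -exprMn lerXn2r ?nnegrE//; lra.
have w0 : 0 < level_weight l by exact: powR_gt0.
have Vw : V / level_weight l <= K0 * 2 `^ (2 * zeta * p * e + (p * l%:R + sigma * j)).
  apply: (@le_trans _ _ (K0 * mesh `^ (2 * zeta * p) / level_weight l)).
    by rewrite ler_wpM2r ?invr_ge0 ?(ltW w0).
  by rewrite -mulrA -powRN opprK -[mesh `^ _]powRrM pow2D -/j (mulrC (- _) (2 * _ * _)).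
have P0 : 0 <= 2 `^ (p * (l%:R + e)) :> R by exact: powR_ge0.
have Bd0 : 0 <= (2 * (level_radius l / (2 ^+ l * mesh) + 3) + 1) ^+ d.
  by rewrite exprn_ge0//; lra.
apply: (@le_trans _ _ (2 `^ (p * (l%:R + e)) *
  ((9 ^+ d * 2 `^ (j * (q - p + sigma) / q * d%:R)) *
   (K0 * 2 `^ (2 * zeta * p * e + (p * l%:R + sigma * j)))))).
  rewrite ler_wpM2l//; apply: (@le_trans _ _ ((2 * (level_radius l / (2 ^+ l * mesh) + 3) + 1) ^+ d *
    (K0 * 2 `^ (2 * zeta * p * e + (p * l%:R + sigma * j))))).
    by rewrite ler_wpM2l.
  by rewrite ler_wpM2r// mulr_ge0// powR_ge0.
set x1 := p * (l%:R + e); set x2 := _ * d%:R; set x3 := _ + (_ + _).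
have -> : 2 `^ x1 * (9 ^+ d * 2 `^ x2 * (K0 * 2 `^ x3)) =
  9 ^+ d * K0 * (2 `^ x1 * 2 `^ x2 * 2 `^ x3) by ring.
rewrite !pow2D ler_wpM2l ?mulr_ge0 ?exprn_ge0// le_pow2//.
have := exponent_le lL; rewrite -/j /x1 /x2 /x3 /e; lra.
Qed.

End exponents.

(** The mesh only takes the values [2^(- L (q - p) / q)]. The largest [L] with [Tm mesh^D >= 1] is
    chosen; one more step would violate this and would divide [mesh^p] by [2^((q - p) p / q)], which
    is the price of rounding. *)
Lemma exists_mesh (R : realType) (p q D Tm : R) : 0 < p -> p < q -> 0 < D -> 1 <= Tm ->
  exists L : nat, 1 <= Tm * mesh p q L `^ D /\
    mesh p q L `^ p <= 2 `^ ((q - p) * p / q) * Tm `^ (- (p / D)).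
Proof.
move=> p0 pq D0 T1.
have q0 : 0 < q by exact: lt_trans pq.
have b0 : 0 < q - p by rewrite subr_gt0.
have T0 : 0 < Tm by exact: lt_le_trans T1.
have ln2 : 0 < ln 2 :> R by rewrite ln_gt0// ltr1n.
pose x := ln Tm / ln 2.
have x0 : 0 <= x by apply: divr_ge0; [exact: ln_ge0|exact: ltW].
have Tx : Tm = 2 `^ x.
  by rewrite /powR pnatr_eq0/= /x divfK ?gt_eqF// lnK// posrE.
pose y := x * q / ((q - p) * D).
have y0 : 0 <= y by apply: divr_ge0; apply: mulr_ge0 => //; exact: ltW.
exists (Num.truncn y); have /andP[Ly yL] := truncn_itv y0.
set L : R := (Num.truncn y)%:R in Ly *.
have c0 : 0 < (q - p) * D / q by rewrite divr_gt0// mulr_gt0.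
have yE : y * ((q - p) * D / q) = x by rewrite /y; field; rewrite !gt_eqF.
rewrite /mesh -!powRrM Tx -powRrM !pow2D -/L; split.
  rewrite one_le_pow2//.
  have : L * ((q - p) * D / q) <= x by rewrite -yE ler_wpM2r// ltW.
  by rewrite (_ : - (L * (q - p) / q) * D = - (L * ((q - p) * D / q))) ?subr_ge0//; ring.
rewrite le_pow2//.
have : y - 1 <= L by rewrite lerBlDr /L natr1 ltW.
have c1 : 0 <= (q - p) * p / q.
    by apply: divr_ge0; [apply: mulr_ge0; exact: ltW|exact: ltW].
move=> /(ler_wpM2r c1).
have -> : x * - (p / D) = - (y * ((q - p) * p / q)).
  by rewrite -yE; field; rewrite !gt_eqF.
by rewrite mulrBl mul1r; lra.
Qed.

(** The bound obtained is free of logarithms, so each logarithmic factor is merely bounded below and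
    divided out. For [Tm >= 2] a nonnegative power of [ln Tm] is at least its value at 2, which may
    be less than 1. *)
Lemma log_factor_ge (R : realType) (a : R) (b : bool) : (b -> 0 <= a) ->
  exists k : R, 0 < k /\ forall Tm : R, 2 <= Tm ->
    k <= ln Tm `^ a * b%:R + (~~ b)%:R.
Proof.
case: b => [/(_ isT) a0|_]; last by exists 1; split=> // Tm _; rewrite mulr0 add0r.
have ln2 : 0 < ln 2 :> R by rewrite ln_gt0// ltr1n.
exists (ln 2 `^ a); split=> [|Tm T2]; first exact: powR_gt0.
rewrite mulr1 addr0; apply: ge0_ler_powR; rewrite ?nnegrE ?(ltW ln2)//.
  by rewrite ln_ge0// (le_trans _ T2)// ler1n.
by rewrite ler_ln ?posrE// (lt_le_trans _ T2).
Qed.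

Theorem theorem1p1 (R : realType) (d : nat)
  (dO : measure_display) (Omega : measurableType dO) (Pr : probability Omega R)
  (X : R -> Omega -> d.-tuple R) (P : R -> R.-pker (d.-tuple R) ~> (d.-tuple R))
  (mu : probability (d.-tuple R) R)
  (C lamE p q : R) :
  is_transition_semigroup P ->
  is_invariant P mu ->
  is_ergodic P mu ->
  is_markov_process Pr X P mu ->
  1 <= C -> 0 < lamE ->
  (forall (nu : probability (d.-tuple R) R) (t : R), 0 <= t ->
     (W1 (mker nu (P t)) (mker mu (P t)) <=
      (C * expR (- lamE * t))%:E * W1 nu mu)%E) ->
  0 < p ->
  Num.max p 1 < q ->
  (\int[mu]_x ((enorm x) `^ q)%:E < +oo)%E ->
  let zeta := Num.max (q / (q - p)) (d%:R / p) in
  exists C' : R, 0 < C' /\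
    forall Tm : R, 2 <= Tm ->
      (\int[Pr]_w Tp p (empirical X Tm w) mu <=
       (C' * Tm `^ (- (p / (2 * zeta * p + 1)))
        * ((ln Tm) `^ (2 * d%:R / (2 * d%:R + 1))
             * (q == d%:R * p / (d%:R - p))%:R
           + (q != d%:R * p / (d%:R - p))%:R)
        * ((ln Tm) `^ (2 * q / (2 * q + q / d%:R - 1))
             * (p == d%:R)%:R
           + (p != d%:R)%:R))%:E)%E.
Proof.
move=> _ invP _ markX C1 lam0 contrP p0; rewrite gt_max => /andP[pq q1] mom zeta.
have C0 : 0 <= C by exact: le_trans C1.
have q0 : 0 < q by exact: lt_trans pq.
have b0 : 0 < q - p by rewrite subr_gt0.
have zq : q <= zeta * (q - p) by rewrite -ler_pdivrMr// /zeta le_max lexx.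
have zd : d%:R <= zeta * p by rewrite -ler_pdivrMr// /zeta le_max lexx orbT.
have zeta0 : 0 < zeta.
  by rewrite -(pmulr_lgt0 _ b0) (lt_le_trans q0).
pose sigma := p / (2 + d%:R / q).
have sigE : sigma * (2 + d%:R / q) = p.
  by rewrite divfK// gt_eqF// ltr_wpDr// divr_ge0// ltW.
have sig0 : 0 < sigma by exact: (sigma_gt0 p0 pq sigE).
pose mq := fine (\int[mu]_x ((enorm x) `^ q)%:E)%E.
have mq0 : 0 <= mq.
  by rewrite fine_ge0//; apply: integral_ge0 => x _; rewrite lee_fin powR_ge0.
pose K0 := 4 * d.+1%:R ^+ 2 * C / lamE.
have K00 : 0 <= K0 by apply: divr_ge0; [exact: mulr_ge0|exact: ltW].
pose K : R := (2 * d%:R) `^ p.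
have KK0 : 0 <= K by exact: powR_ge0.
pose A := 2 + 2 * mq.
have A0 : 0 <= A by rewrite addr_ge0// mulr_ge0.
have AK0 : 0 <= 2 * A + 9 ^+ d * K0.
  by apply: addr_ge0; apply: mulr_ge0 => //; exact: exprn_ge0.
pose r : R := 2 `^ (- sigma).
have r0 : 0 < r by exact: powR_gt0.
have r1 : r < 1.
  rewrite /r powRN invf_lt1 ?powR_gt0//.
  have : 1 `^ sigma < 2 `^ sigma :> R by apply: gt0_ltr_powR; rewrite ?nnegrE ?ltr1n.
  by rewrite powR1.
pose S := 2 `^ p * (2 * A + 9 ^+ d * K0) * (1 - r)^-1.
pose C2 := K * (1 + S) + K * (2 * mq).
have mesh_bound (L : nat) (Tm : R) : 0 < Tm ->
    1 <= Tm * mesh p q L `^ (2 * zeta * p + 1) ->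
    (\int[Pr]_w Tp p (empirical X Tm w) mu <= (C2 * mesh p q L `^ p)%:E)%E.
  move=> T0 Tmesh; pose eps := mesh p q L.
  have eps0 : 0 < eps by exact: mesh_gt0.
  have key := mean_transport_le (L := L) invP markX C0 lam0 contrP p0 pq q1 mom eps0 T0
    (tau := level_weight p sigma L) (rho := level_radius p q sigma L).
  have {}key := key (fun l lL => And4 (powR_gt0 _ (ltr0n R 2)) (powR_gt0 _ (ltr0n R 2))
    (level_radius_le p0 pq sigE lL) (eq_ind_r (fun z => z <= _) (lexx _) (level_radius_weight sigma L p0 pq l))).
  apply: (le_trans key); rewrite lee_fin -/K -/mq -/A.
  (* The [+ 1] in the exponent of [Tmesh] pays for the factor [1 / eps] in the fluctuation, which is
     the Lipschitz constant of the cells. *)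
  have Vle : fluctuation d C lamE eps Tm <= K0 * eps `^ (2 * zeta * p).
    rewrite /fluctuation -/K0 ler_wpM2l// -[_^-1]mul1r ler_pdivrMr ?mulr_gt0//.
    apply: (le_trans Tmesh); rewrite -/eps powRD ?(gt_eqF eps0) ?implybT// powRr1 ?(ltW eps0)//.
    by rewrite le_eqVlt; apply/orP; left; apply/eqP; ring.
  have ep0 : 0 <= eps `^ p by exact: powR_ge0.
  set Sig := \sum_(l < L.+1) _.
  have SigS : Sig <= S * eps `^ p.
    apply: (@le_trans _ _ (\sum_(l < L.+1) 2 `^ p * eps `^ p * (2 * A + 9 ^+ d * K0) * r ^+ (L - l))).
      apply: ler_sum => l _.
      exact: (level_term_le p0 pq zq zd sigE (ltn_ord l : (l <= L)%N) A0 K00 Vle).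
    rewrite -mulr_sumr.
    have -> : S * eps `^ p = 2 `^ p * eps `^ p * (2 * A + 9 ^+ d * K0) * (1 - r)^-1 by rewrite /S; ring.
    apply: ler_wpM2l; last exact: sum_geometric_rev_le.
    by apply: mulr_ge0 => //; apply: mulr_ge0 => //; exact: powR_ge0.
  rewrite (top_scale_pow L p0 pq) -/eps.
  have -> : C2 * eps `^ p = K * (eps `^ p + S * eps `^ p) + K * eps `^ p * (2 * mq) by rewrite /C2; ring.
  by rewrite lerD2r ler_wpM2l// lerD2l.
have S0 : 0 <= S.
  apply: mulr_ge0; last by rewrite invr_ge0 subr_ge0 ltW.
  by apply: mulr_ge0 => //; exact: powR_ge0.
have C20 : 0 <= C2 by rewrite addr_ge0 ?mulr_ge0 ?addr_ge0.
have D0 : 0 < 2 * zeta * p + 1 by rewrite addr_gt0 ?mulr_gt0.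
have [k1 [k10 k1le]] := @log_factor_ge R (2 * d%:R / (2 * d%:R + 1)) (q == d%:R * p / (d%:R - p))
  (fun _ => divr_ge0 (mulr_ge0 (ler0n R 2) (ler0n R d)) (addr_ge0 (mulr_ge0 (ler0n R 2) (ler0n R d)) ler01)).
have [k2 [k20 k2le]] : exists k : R, 0 < k /\ forall Tm : R, 2 <= Tm ->
    k <= ln Tm `^ (2 * q / (2 * q + q / d%:R - 1)) * (p == d%:R)%:R + (p != d%:R)%:R.
  apply: log_factor_ge => /eqP pd.
  have d0 : 0 < d%:R :> R by rewrite -pd.
  have qd : 1 <= q / d%:R by rewrite ler_pdivlMr// mul1r -pd ltW.
  by apply: divr_ge0; lra.
(* [C2] vanishes for [d = 0]; adding 1 makes the final constant positive. *)
pose B := (C2 + 1) * 2 `^ ((q - p) * p / q).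
have B0 : 0 < B by rewrite mulr_gt0 ?powR_gt0// ltr_wpDl.
exists (B / (k1 * k2)); split=> [|Tm T2]; first by rewrite divr_gt0// mulr_gt0.
have T1 : 1 <= Tm by lra.
have T0 : 0 < Tm by lra.
have [L [LT Lle]] := exists_mesh p0 pq D0 T1.
apply: (le_trans (mesh_bound L Tm T0 LT)); rewrite lee_fin.
have := k1le Tm T2; have := k2le Tm T2.
set F1 := (X in _ <= X -> _); set F2 := (X in _ -> _ <= X -> _) => F1k F2k.
set t := Tm `^ _ in Lle *.
have t0 : 0 <= t by exact: powR_ge0.
apply: (@le_trans _ _ (B * t)).
  apply: (@le_trans _ _ ((C2 + 1) * mesh p q L `^ p)).
    by rewrite ler_wpM2r ?powR_ge0// lerDl.
  by rewrite /B -mulrA ler_wpM2l// addr_ge0.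
have -> : B / (k1 * k2) * t * F2 * F1 = B * t * ((F2 / k1) * (F1 / k2)).
  by field; rewrite !gt_eqF.
have a1 : 1 <= F2 / k1 by rewrite ler_pdivlMr// mul1r.
have a2 : 1 <= F1 / k2 by rewrite ler_pdivlMr// mul1r.
apply: ler_peMr; first by apply: mulr_ge0 => //; exact: ltW.
by apply: (le_trans a1); apply: ler_peMr => //; apply: le_trans a1.
Qed.
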